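(* Let $R$ be a commutative noetherian ring and let $\Lambda$ be a noetherian $R$-algebra. Let $i\geq 0$ be an integer and $P,Q\in\mathrm{Spec}\,\Lambda$. Then $$\mathrm{Ext}^i_{\Lambda}(\widetilde{P},\widetilde{Q})\cong\begin{cases}\mathrm{Ext}^i_{\Lambda_{\mathfrak p}}(S(P),S(Q)) & \text{if } P\cap R=Q\cap R=:\mathfrak{p},\\ 0 & \text{otherwise,}\end{cases}$$ where, for $P$ with $P\cap R=\mathfrak p$, $S(P)$ is the simple right $\Lambda_{\mathfrak p}$-module corresponding to $P$. (The isomorphism is one of abelian groups.)
   Context: A noetherian $R$-algebra is a ring $\Lambda$ whose center contains $R$ as a subring and which is finitely generated as an $R$-module. $\mathrm{Spec}\,\Lambda$ is the set of prime two-sided ideals. For $P\in\mathrm{Spec}\,\Lambda$, $P\cap R$ is a prime ideal of $R$; for $\mathfrak p\in\mathrm{Spec}\,R$, $\Lambda_{\mathfrak p}$ is the localization. Modules are right modules. Atoms. In an abelian category $\mathcal{A}$, a monoform object is a nonzero object $H$ having no subobjects $0\neq L'\subsetneq L\subset H$ and $0\neq N\subset H$ with $L/L'\cong N$. Two monoform objects are atom-equivalent if they have isomorphic nonzero subobjects (an equivalence relation). $\mathrm{ASpec}\,\mathcal{A}$ is the set of equivalence classes $\overline{H}$, called atoms. $\mathrm{AAss}\,M:=\{\overline{H}\mid H\text{ is a monoform subobject of }M\}$. If $\mathcal{A}$ is a Grothendieck category and $\alpha=\overline{H}$, then $E(\alpha)$ denotes the injective envelope $E(H)$; its isomorphism class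 depends only on $\alpha$. It is known that for each $P\in\mathrm{Spec}\,\Lambda$ there is a unique atom $\widetilde{P}\in\mathrm{ASpec}(\mathrm{Mod}\,\Lambda)$ with $\mathrm{AAss}(\Lambda/P)=\{\widetilde{P}\}$, and $P\mapsto\widetilde{P}$ is a bijection $\mathrm{Spec}\,\Lambda\to\mathrm{ASpec}(\mathrm{Mod}\,\Lambda)$. Put $I(P):=E(\widetilde{P})$ and $S(P):=\{x\in I(P)\mid xP=0\}$. With $\mathfrak p=P\cap R$, it is known that $I(P)$ and $S(P)$ are canonically right $\Lambda_{\mathfrak p}$-modules (the maps $I(P)\to I(P)_{\mathfrak p}$, $S(P)\to S(P)_{\mathfrak p}$ are isomorphisms), that $S(P)$ is the unique simple $\Lambda_{\mathfrak p}$-submodule of $I(P)$, and that $S(P)$ is a monoform $\Lambda$-module representing $\widetilde P$. We take $S(P)$ as the fixed representative of $\widetilde{P}$. Extension groups. For an atom $\alpha$ with fixed representative $H$ and an object $N$, $\mathrm{Ext}^i_{\mathcal{A}}(\alpha,N):=\varinjlim_{0\neq H'\subset H}\mathrm{Ext}^i_{\mathcal{A}}(H',N)$ (direct limit over nonzero subobjects of $H$ ordered by reverse inclusion). For an atom $\beta$ with fixed representative $K$, $\mathrm{Ext}^i_{\mathcal{A}}(\alpha,\beta):=\varprojlim_{0\neq K'\subset K}\mathrm{Ext}^i_{\mathcal{A}}(\alpha,K')$. We write $\mathrm{Ext}_\Lambda$ for $\mathrm{Ext}_{\mathrm{Mod}\,\Lambda}$. *)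

(* Defs.v *)
From HB Require Import structures.
From mathcomp Require Import all_boot all_algebra.
From mathcomp Require Import generic_quotient ring_quotient boolp functions.
From mathcomp Require Import freeg.
Set Implicit Arguments. Unset Strict Implicit. Unset Printing Implicit Defensive.
Import GRing.Theory.
Local Open Scope ring_scope.
Local Open Scope quotient_scope.

(* Modules are MathComp left modules; right modules over a ring B are the left
   modules over the converse ring B^c, with x b written (b : B^c) *: x. *)

Structure submodule (A : nzRingType) (M : lmodType A) := Submodule {
  submod_pred :> {pred M};
  submod_predP : submod_closed submod_pred
}.

HB.instance Definition _ (A : nzRingType) (M : lmodType A) (L : submodule M) :=
  GRing.isSubmodClosed.Build A M (submod_pred L) (submod_predP L).

Section SubQuo.
Variables (A : nzRingType) (M : lmodType A) (L : submodule M).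

Record submod := SubMod { smval : M; smvalP : smval \in L }.
HB.instance Definition _ := [isSub for smval].
HB.instance Definition _ := [Choice of submod by <:].
HB.instance Definition _ := [SubChoice_isSubLmodule of submod by <:].

Fact smval_linear : linear smval.
Proof. exact: (linearP (val : submod -> M)). Qed.
HB.instance Definition _ := GRing.isLinear.Build A submod M *:%R smval smval_linear.

Definition quotmod := {ideal_quot L}.
HB.instance Definition _ := GRing.Zmodule.on quotmod.

Definition qscale (a : A) (x : quotmod) : quotmod :=
  \pi_{ideal_quot L} (a *: repr (x : {ideal_quot L})).

Fact pi_scale a (x : M) :
  qscale a (\pi_{ideal_quot L} x) = \pi_{ideal_quot L} (a *: x).
Proof.
apply/eqP; rewrite -Quotient.idealrBE -scalerBr rpredZ //.
by rewrite Quotient.idealrBE reprK.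
Qed.

Fact qscaleA a b (v : quotmod) : qscale a (qscale b v) = qscale (a * b) v.
Proof. by rewrite -[v](@reprK _ {ideal_quot L}) !pi_scale scalerA. Qed.

Fact qscale1 : left_id 1 qscale.
Proof. by move=> v; rewrite -[v](@reprK _ {ideal_quot L}) pi_scale scale1r. Qed.

Fact qscaleDr : right_distributive qscale +%R.
Proof.
move=> a u v.
rewrite -[u](@reprK _ {ideal_quot L}) -[v](@reprK _ {ideal_quot L}) !pi_scale.
have piD x y : \pi x + \pi y = \pi_{ideal_quot L} (x + y) by rewrite raddfD.
by rewrite -[qscale a (_ + _)]/(qscale a (\pi _ + \pi _)) !piD pi_scale scalerDr.
Qed.

Fact qscaleDl v : {morph qscale^~ v : a b / a + b}.
Proof.
move=> a b; rewrite -[v](@reprK _ {ideal_quot L}) !pi_scale.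
by rewrite scalerDl raddfD.
Qed.

HB.instance Definition _ := GRing.Zmodule_isLmodule.Build A quotmod
  qscaleA qscale1 qscaleDr qscaleDl.
End SubQuo.

Section Kernels.
Variable A : nzRingType.
Implicit Types M N : lmodType A.

Fact ker_submod_closed M N (f : {linear M -> N}) :
  submod_closed [pred x | f x == 0].
Proof.
split=> [|a x y]; rewrite !inE ?raddf0 // => /eqP fx /eqP fy.
by rewrite linearP fx fy scaler0 addr0.
Qed.
Definition kernel M N (f : {linear M -> N}) : submodule M :=
  Submodule (ker_submod_closed f).

Fact preim_submod_closed M N (f : {linear M -> N}) (L : submodule N) :
  submod_closed [pred x | f x \in L].
Proof.
split=> [|a x y]; rewrite !inE ?raddf0 ?rpred0 // => fx fy.
by rewrite linearP rpredD ?rpredZ.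
Qed.
Definition preim_submod M N (f : {linear M -> N}) (L : submodule N) :=
  Submodule (preim_submod_closed f L).

Section Inclusion.
Variables (M : lmodType A) (L' L : submodule M) (sL : {subset L' <= L}).
Definition incl (x : submod L') : submod L := SubMod (sL (smvalP x)).
Fact incl_linear : linear incl.
Proof. by move=> a x y; apply: val_inj => /=; rewrite ?linearP. Qed.
HB.instance Definition _ :=
  GRing.isLinear.Build A (submod L') (submod L) *:%R incl incl_linear.
End Inclusion.

Section KerMap.
Variables (M N M' N' : lmodType A) (g : {linear M -> N}) (g' : {linear M' -> N'}).
Variables (u : {linear M -> M'}) (v : {linear N -> N'}).
Hypothesis comm : forall x, g' (u x) = v (g x).
Fact kermap_subproof (x : submod (kernel g)) : u (smval x) \in kernel g'.
Proof. by case: x => x /= /eqP gx; rewrite inE comm gx raddf0. Qed.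
Definition kermap (x : submod (kernel g)) : submod (kernel g') :=
  SubMod (kermap_subproof x).
Fact kermap_linear : linear kermap.
Proof. by move=> a x y; apply: val_inj => /=; rewrite ?linearP. Qed.
HB.instance Definition _ := GRing.isLinear.Build A (submod (kernel g))
  (submod (kernel g')) *:%R kermap kermap_linear.
End KerMap.
End Kernels.

Section Free.
Variable A : nzRingType.

Section Lift.
Variables (T : choiceType) (M : lmodType A) (f : T -> M).
Fact fglift_additive : zmod_morphism (fglift f).
Proof. exact: lift_is_additive. Qed.
HB.instance Definition _ :=
  GRing.isZmodMorphism.Build {freeg T / A} M (fglift f) fglift_additive.
Fact fglift_scalable : scalable (fglift f).
Proof.
move=> c D; rewrite -[X in _ = c *: fglift f X]freeg_sumE.
rewrite [LHS](raddf_sum (fglift f)) [X in c *: X](raddf_sum (fglift f)) scaler_sumr.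
by apply: eq_bigr => x _ /=; rewrite !liftU scalerA.
Qed.
HB.instance Definition _ :=
  GRing.isScalable.Build A {freeg T / A} M *:%R (fglift f) fglift_scalable.
End Lift.

Lemma freeg_ext (T : choiceType) (M : lmodType A)
    (f g : {linear {freeg T / A} -> M}) :
  (forall x, f << x >> = g << x >>) -> f =1 g.
Proof.
move=> fg D; rewrite -[D]freeg_sumE !raddf_sum /=; apply: eq_bigr => x _.
have -> : << coeff x D *g x >> = coeff x D *: << x >> :> {freeg T / A}.
  apply/eqP/freeg_eqP => y; rewrite coeffZ !coeffU.
  by rewrite mul1r.
by rewrite !linearZ fg.
Qed.

Definition freemap (T T' : choiceType) (f : T -> T') :
    {linear {freeg T / A} -> {freeg T' / A}} :=
  fglift (fun x => << f x >>).

Lemma freemapU (T T' : choiceType) (f : T -> T') x :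
  freemap f << x >> = << f x >>.
Proof. by rewrite /= liftU scale1r. Qed.

Definition aug (M : lmodType A) : {linear {freeg M / A} -> M} := fglift idfun.

Lemma augU (M : lmodType A) (x : M) : aug M << x >> = x.
Proof. by rewrite /= liftU scale1r. Qed.

Lemma aug_nat (M M' : lmodType A) (f : {linear M -> M'}) x :
  aug M' (freemap f x) = f (aug M x).
Proof.
move: x; apply: (@freeg_ext M M' (aug M' \o freemap f) (f \o aug M)) => x.
by rewrite /= !(liftU, scale1r).
Qed.
End Free.

(* {freeg T / A} is the free left A-module on the set T.  Every module M has the
   functorial free resolution
     ... -> res 1 M -> res 0 M -> M -> 0,   res n M = {freeg (syz n M) / A},
   where syz 0 M = M and syz n.+1 M is the kernel of the canonical surjection
   aug : {freeg (syz n M) / A} -> syz n M, <<x>> |-> x. *)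
Section Resolution.
Variable A : nzRingType.
Implicit Types M N : lmodType A.

Fixpoint syz (n : nat) M : lmodType A :=
  if n is n'.+1 then submod (kernel (aug (syz n' M))) else M.

Definition res n M : lmodType A := {freeg (syz n M) / A}.

Definition dres n M : {linear res n.+1 M -> res n M} :=
  smval (L := kernel (aug (syz n M))) \o aug (syz n.+1 M).

Lemma aug_surj M (x : M) : exists y : res 0 M, aug M y = x.
Proof. by exists << x >>; rewrite augU. Qed.

Lemma aug_exact M (y : res 0 M) :
  aug M y = 0 <-> exists z : res 1 M, dres 0 M z = y.
Proof.
split=> [y0 | [z <-]]; last exact: (eqP (smvalP (aug (syz 1 M) z))).
have y0' : y \in kernel (aug (syz 0 M)) by apply/eqP.
by exists << SubMod y0' >>; rewrite /dres /= liftU scale1r.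
Qed.

Lemma dres_exact n M (y : res n.+1 M) :
  dres n M y = 0 <-> exists z : res n.+2 M, dres n.+1 M z = y.
Proof.
split=> [y0 | [z <-]]; last first.
  by rewrite /dres /= (eqP (smvalP (aug (syz n.+2 M) z))).
have y0' : y \in kernel (aug (syz n.+1 M)).
  by apply/eqP/val_inj; rewrite -[LHS]/(dres n M y) y0.
by exists << SubMod y0' >>; rewrite /dres /= liftU scale1r.
Qed.

Fixpoint syzmap n M M' (f : {linear M -> M'}) :
    {linear syz n M -> syz n M'} :=
  if n is n'.+1 then kermap (aug_nat (syzmap n' f)) else f.

Definition resmap n M M' (f : {linear M -> M'}) :
  {linear res n M -> res n M'} := freemap A (syzmap n f).

Lemma dres_nat n M M' (f : {linear M -> M'}) x :
  dres n M' (resmap n.+1 f x) = resmap n f (dres n M x).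
Proof. by rewrite /dres /= aug_nat. Qed.
End Resolution.

Section Hom.
Variable A : nzRingType.
Implicit Types M N : lmodType A.

Definition lin_pred M N : {pred M -> N} := fun f => `[< linear f >].
Fact lin_zmod_closed M N : zmod_closed (@lin_pred M N).
Proof.
split=> [|f g /asboolP lf /asboolP lg]; apply/asboolP => a x y /=.
  by rewrite addr0 scaler0.
rewrite /GRing.add /GRing.opp /= lf lg scalerBr opprD addrACA //.
Qed.
HB.instance Definition _ M N :=
  GRing.isZmodClosed.Build (M -> N) (@lin_pred M N) (lin_zmod_closed M N).

Record hom M N := Hom { homf :> M -> N; homP : homf \in @lin_pred M N }.
HB.instance Definition _ M N := [isSub for @homf M N].
HB.instance Definition _ M N := [Choice of hom M N by <:].
HB.instance Definition _ M N := [SubChoice_isSubZmodule of hom M N by <:].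

Fact precomp_lin M M' N (u : {linear M -> M'}) (f : hom M' N) :
  f \o u \in @lin_pred M N.
Proof.
by apply/asboolP => a x y /=; rewrite linearP (asboolP _ (homP f)).
Qed.
Definition precomp M M' N (u : {linear M -> M'}) (f : hom M' N) : hom M N :=
  Hom (precomp_lin u f).

Fact postcomp_lin M N N' (v : {linear N -> N'}) (f : hom M N) :
  v \o f \in @lin_pred M N'.
Proof.
by apply/asboolP => a x y /=; rewrite (asboolP _ (homP f)) linearP.
Qed.
Definition postcomp M N N' (v : {linear N -> N'}) (f : hom M N) : hom M N' :=
  Hom (postcomp_lin v f).

Fact precomp_zmod M M' N u : zmod_morphism (@precomp M M' N u).
Proof. by move=> f g; apply: val_inj. Qed.
HB.instance Definition _ M M' N u := GRing.isZmodMorphism.Build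
  (hom M' N) (hom M N) (@precomp M M' N u) (precomp_zmod u).

Fact postcomp_zmod M N N' v : zmod_morphism (@postcomp M N N' v).
Proof.
by move=> f g; apply: val_inj; apply/funext => x; apply: (raddfB v).
Qed.
HB.instance Definition _ M N N' v := GRing.isZmodMorphism.Build
  (hom M N) (hom M N') (@postcomp M N N' v) (postcomp_zmod v).

Lemma precomp_postcomp M M' N N' (u : {linear M -> M'}) (v : {linear N -> N'}) f :
  precomp u (postcomp v f) = postcomp v (precomp u f).
Proof. exact: val_inj. Qed.
End Hom.

Section QuotMap.
Variables (V V' : zmodType) (B : zmodClosed V) (B' : zmodClosed V').
Variable f : {additive V -> V'}.

Definition quotmap (fB : forall x, x \in B -> f x \in B')
    (q : {ideal_quot B}) : {ideal_quot B'} :=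
  \pi_{ideal_quot B'} (f (repr q)).

Hypothesis fB : forall x, x \in B -> f x \in B'.

Lemma quotmap_pi x : quotmap fB (\pi x) = \pi_{ideal_quot B'} (f x).
Proof.
apply/eqP; rewrite -Quotient.idealrBE -raddfB fB //.
by rewrite Quotient.idealrBE reprK.
Qed.

Fact quotmap_zmod : zmod_morphism (quotmap fB).
Proof.
move=> p q; rewrite -[p]reprK -[q]reprK.
by rewrite -[_ - _ in LHS]raddfB !quotmap_pi -[RHS]raddfB -raddfB.
Qed.
HB.instance Definition _ := GRing.isZmodMorphism.Build
  {ideal_quot B} {ideal_quot B'} (quotmap fB) quotmap_zmod.
End QuotMap.

(* Ext^n(M, N) is the n-th cohomology group of the complex hom (res _ M) N. *)
Section Ext.
Variable A : nzRingType.
Implicit Types M N : lmodType A.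

Definition cocycle_pred n M N : {pred hom (res n M) N} :=
  fun f => precomp (dres n M) f == 0.
Fact cocycle_zmod_closed n M N : zmod_closed (@cocycle_pred n M N).
Proof.
split=> [|f g /eqP f0 /eqP g0]; apply/eqP; first exact: raddf0.
by rewrite raddfB /= f0 g0 subrr.
Qed.
HB.instance Definition _ n M N := GRing.isZmodClosed.Build
  (hom (res n M) N) (@cocycle_pred n M N) (@cocycle_zmod_closed n M N).

Record cocycle n M N := Cocycle {
  cochain : hom (res n M) N;
  cocycleP : cochain \in @cocycle_pred n M N
}.
HB.instance Definition _ n M N := [isSub for @cochain n M N].
HB.instance Definition _ n M N := [Choice of cocycle n M N by <:].
HB.instance Definition _ n M N :=
  [SubChoice_isSubZmodule of cocycle n M N by <:].

Definition coboundary_pred n M N : {pred cocycle n M N} :=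
  match n with
  | 0 => fun f => f == 0
  | n'.+1 => fun f =>
      `[< exists g : hom (res n' M) N, cochain f = precomp (dres n' M) g >]
  end.
Fact coboundary_zmod_closed n M N : zmod_closed (@coboundary_pred n M N).
Proof.
case: n => [|n]; split=> /=.
- by rewrite unfold_in.
- by move=> f g; rewrite !unfold_in => /eqP-> /eqP->; rewrite subrr.
- by apply/asboolP; exists 0; rewrite raddf0.
- move=> f g /asboolP[f' ff'] /asboolP[g' gg']; apply/asboolP.
  by exists (f' - g'); rewrite [RHS]raddfB [RHS]/= -ff' -gg'.
Qed.
HB.instance Definition _ n M N := GRing.isZmodClosed.Build
  (cocycle n M N) (@coboundary_pred n M N) (@coboundary_zmod_closed n M N).

Definition Ext n M N : zmodType := {ideal_quot (@coboundary_pred n M N)}.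

Section Pull.
Variables (n : nat) (M M' N : lmodType A) (u : {linear M -> M'}).
Fact coc_pull_subproof (f : cocycle n M' N) :
  precomp (resmap n u) (cochain f) \in @cocycle_pred n M N.
Proof.
apply/eqP/val_inj/funext => x /=; rewrite -dres_nat.
exact: (congr1 (fun h : hom _ _ => h _) (eqP (cocycleP f))).
Qed.
Definition coc_pull (f : cocycle n M' N) : cocycle n M N :=
  Cocycle (coc_pull_subproof f).
Fact coc_pull_zmod : zmod_morphism coc_pull.
Proof. by move=> f g; apply: val_inj; apply: raddfB. Qed.
HB.instance Definition _ := GRing.isZmodMorphism.Build
  (cocycle n M' N) (cocycle n M N) coc_pull coc_pull_zmod.
End Pull.

Fact coc_pull_coboundary n M M' N (u : {linear M -> M'}) (f : cocycle n M' N) :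
  f \in @coboundary_pred n M' N -> coc_pull u f \in @coboundary_pred n M N.
Proof.
case: n f => [|n] f.
  by rewrite !unfold_in /= => /eqP->; rewrite raddf0.
move=> /asboolP[g fg]; apply/asboolP; exists (precomp (resmap n u) g).
apply: val_inj; apply/funext => x /=.
by rewrite -dres_nat fg.
Qed.
Definition ext_pull n M M' N (u : {linear M -> M'}) :
    {additive Ext n M' N -> Ext n M N} :=
  @quotmap _ _ _ _ _ (@coc_pull_coboundary n M M' N u).

Section Push.
Variables (n : nat) (M N N' : lmodType A) (v : {linear N -> N'}).
Fact coc_push_subproof (f : cocycle n M N) :
  postcomp v (cochain f) \in @cocycle_pred n M N'.
Proof.
by apply/eqP; rewrite precomp_postcomp (eqP (cocycleP f)) raddf0.
Qed.
Definition coc_push (f : cocycle n M N) : cocycle n M N' :=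
  Cocycle (coc_push_subproof f).
Fact coc_push_zmod : zmod_morphism coc_push.
Proof. by move=> f g; apply: val_inj; apply: raddfB. Qed.
HB.instance Definition _ := GRing.isZmodMorphism.Build
  (cocycle n M N) (cocycle n M N') coc_push coc_push_zmod.
End Push.

Fact coc_push_coboundary n M N N' (v : {linear N -> N'}) (f : cocycle n M N) :
  f \in @coboundary_pred n M N -> coc_push v f \in @coboundary_pred n M N'.
Proof.
case: n f => [|n] f.
  by rewrite !unfold_in /= => /eqP->; rewrite raddf0.
move=> /asboolP[g fg]; apply/asboolP; exists (postcomp v g).
by rewrite precomp_postcomp /= fg.
Qed.
Definition ext_push n M N N' (v : {linear N -> N'}) :
    {additive Ext n M N -> Ext n M N'} :=
  @quotmap _ _ _ _ _ (@coc_push_coboundary n M N N' v).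

Lemma ext_pull_push n M M' N N' (u : {linear M -> M'}) (v : {linear N -> N'}) x :
  ext_push n M v (ext_pull n N u x) = ext_pull n N' u (ext_push n M' v x).
Proof.
rewrite -[x]reprK /= !quotmap_pi; congr (\pi _); exact/val_inj/val_inj.
Qed.
End Ext.

(* The direct limit of a system of abelian groups, given by generators (i, x),
   x in X i, and relations; colim_desc and colim_ext below are its universal
   property.  This presentation does not need the index set to be directed. *)
Section Colimit.
Variables (I : choiceType) (le : I -> I -> Prop) (X : I -> zmodType).
Variable t : forall i j, le i j -> {additive X i -> X j}.

Definition formal (i : I) (x : X i) : {freeg {i : I & X i} / int} :=
  << Tagged X x >>.

Inductive colim_rel : {freeg {i : I & X i} / int} -> Prop :=
| ColimAdd i (x y : X i) :
    colim_rel (formal (x + y) - (formal x + formal y))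
| ColimMap i j (h : le i j) (x : X i) : colim_rel (formal (t h x) - formal x).

Definition colim_pred : {pred {freeg {i : I & X i} / int}} := fun z =>
  `[< forall S : {pred {freeg {i : I & X i} / int}},
        zmod_closed S -> (forall r, colim_rel r -> r \in S) -> z \in S >].
Fact colim_zmod_closed : zmod_closed colim_pred.
Proof.
split=> [|x y /asboolP xS /asboolP yS]; apply/asboolP => S Sz Sr.
  by case: Sz.
by case: (Sz) => _; apply; [apply: xS | apply: yS].
Qed.
HB.instance Definition _ :=
  GRing.isZmodClosed.Build {freeg {i : I & X i} / int} colim_pred colim_zmod_closed.

Definition colim : zmodType := {ideal_quot colim_pred}.

Definition colim_in i (x : X i) : colim := \pi_{ideal_quot colim_pred} (formal x).

Lemma colim_relP z : colim_rel z -> z \in colim_pred.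
Proof. by move=> rz; apply/asboolP => S _; apply. Qed.

Fact colim_in_zmod i : zmod_morphism (@colim_in i).
Proof.
have D x y : @colim_in i (x + y) = colim_in x + colim_in y.
  apply/eqP; rewrite /colim_in -[eqbRHS]raddfD -Quotient.idealrBE.
  exact/colim_relP/ColimAdd.
by move=> x y; have /eqP := D (x - y) y; rewrite subrK -subr_eq => /eqP.
Qed.
HB.instance Definition _ i :=
  GRing.isZmodMorphism.Build (X i) colim (@colim_in i) (@colim_in_zmod i).

Lemma colim_inP i j (h : le i j) (x : X i) : colim_in (t h x) = colim_in x.
Proof.
by apply/eqP; rewrite -Quotient.idealrBE; exact/colim_relP/ColimMap.
Qed.

Section Desc.
Variables (Y : zmodType) (g : forall i, {additive X i -> Y}).
Hypothesis gt : forall i j (h : le i j) (x : X i), g j (t h x) = g i x.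

(* zmodule Y is Y as a module over int *)
Definition predesc : {linear {freeg {i : I & X i} / int} -> zmodule Y} :=
  fglift (fun p : {i : I & X i} => g (tag p) (tagged p) : zmodule Y).

Fact predesc_formal i (x : X i) : predesc (formal x) = g i x.
Proof. by rewrite /= liftU scale1r. Qed.

Fact predesc_rel z : z \in colim_pred -> predesc z = 0.
Proof.
move=> /asboolP /(_ [pred z | predesc z == 0]) zS; apply/eqP/zS => [|r].
  split=> [|x y /eqP x0 /eqP y0]; apply/eqP; first exact: raddf0.
  by rewrite [LHS]raddfB [X in X - _]x0 [X in _ - X]y0 subrr.
case=> [i x y | i j h x]; apply/eqP.
  rewrite !(raddfB, raddfD) /= !liftU !scale1r /= raddfD -opprD.
  exact: (subrr (g i x + g i y)).
by rewrite raddfB /= !liftU !scale1r /= gt; exact: (subrr (g i x)).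
Qed.

Definition colim_desc_fun (_ : forall i j (h : le i j) (x : X i), g j (t h x) = g i x)
  (q : colim) : Y := predesc (repr (q : {ideal_quot colim_pred})).

Fact colim_desc_pi z : colim_desc_fun gt (\pi_{ideal_quot colim_pred} z) = predesc z.
Proof.
apply/eqP; rewrite -subr_eq0 /colim_desc_fun -[_ - _](raddfB predesc).
by apply/eqP/predesc_rel; rewrite Quotient.idealrBE reprK.
Qed.

Fact colim_desc_zmod : zmod_morphism (colim_desc_fun gt).
Proof.
move=> p q; rewrite -[p](@reprK _ {ideal_quot colim_pred}).
rewrite -[q](@reprK _ {ideal_quot colim_pred}).
by rewrite -[_ - _ in LHS]raddfB !colim_desc_pi raddfB.
Qed.
HB.instance Definition _ :=
  GRing.isZmodMorphism.Build colim Y (colim_desc_fun gt) colim_desc_zmod.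

Definition colim_desc : {additive colim -> Y} := colim_desc_fun gt.

Lemma colim_descE i (x : X i) : colim_desc (colim_in x) = g i x.
Proof. by rewrite /= colim_desc_pi predesc_formal. Qed.
End Desc.

Lemma colim_ext (Y : zmodType) (f g : {additive colim -> Y}) :
  (forall i (x : X i), f (colim_in x) = g (colim_in x)) -> f =1 g.
Proof.
move=> fg q; rewrite -[q](@reprK _ {ideal_quot colim_pred}).
set z := repr _; rewrite -[z]freeg_sumE !raddf_sum /=.
apply: eq_bigr => -[i x] _; set k := coeff _ _.
have -> : << k *g existT X i x >> = formal x *~ k.
  by rewrite freeg_mulz; congr << _ *g _ >>; rewrite intz.
by rewrite !raddfMz fg.
Qed.
End Colimit.

Section ColimMap.
Variables (I : choiceType) (le : I -> I -> Prop) (X Y : I -> zmodType).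
Variable tX : forall i j, le i j -> {additive X i -> X j}.
Variable tY : forall i j, le i j -> {additive Y i -> Y j}.
Variable f : forall i, {additive X i -> Y i}.
Hypothesis ft : forall i j (h : le i j) (x : X i), f j (tX h x) = tY h (f i x).

Fact colim_map_subproof i j (h : le i j) (x : X i) :
  colim_in tY (f j (tX h x)) = colim_in tY (f i x).
Proof. by rewrite ft colim_inP. Qed.
Definition colim_map : {additive colim tX -> colim tY} :=
  @colim_desc _ _ _ _ _ (fun i => @colim_in _ _ _ tY i \o f i) colim_map_subproof.
End ColimMap.

Section Limit.
Variables (I : Type) (le : I -> I -> Prop) (X : I -> zmodType).
Variable t : forall i j, le i j -> {additive X i -> X j}.

Definition depprod := forall i, X i.
HB.instance Definition _ := Choice.on depprod.

Definition depprod_zero : depprod := fun i => 0.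
Definition depprod_opp (f : depprod) : depprod := fun i => - f i.
Definition depprod_add (f g : depprod) : depprod := fun i => f i + g i.
Fact depprod_addA : associative depprod_add.
Proof. by move=> f g h; apply/functional_extensionality_dep => i; apply: addrA. Qed.
Fact depprod_addC : commutative depprod_add.
Proof. by move=> f g; apply/functional_extensionality_dep => i; apply: addrC. Qed.
Fact depprod_add0 : left_id depprod_zero depprod_add.
Proof. by move=> f; apply/functional_extensionality_dep => i; apply: add0r. Qed.
Fact depprod_addN : left_inverse depprod_zero depprod_opp depprod_add.
Proof. by move=> f; apply/functional_extensionality_dep => i; apply: addNr. Qed.
HB.instance Definition _ := GRing.isZmodule.Build depprod
  depprod_addA depprod_addC depprod_add0 depprod_addN.

Definition lim_pred : {pred depprod} := fun f =>
  `[< forall i j (h : le i j), t h (f i) = f j >].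
Fact lim_zmod_closed : zmod_closed lim_pred.
Proof.
split=> [|f g /asboolP ft /asboolP gt]; apply/asboolP => i j h.
  exact: raddf0.
by rewrite [LHS]raddfB ft gt.
Qed.
HB.instance Definition _ :=
  GRing.isZmodClosed.Build depprod lim_pred lim_zmod_closed.

Record lim := Lim { limf : depprod; limP : limf \in lim_pred }.
HB.instance Definition _ := [isSub for limf].
HB.instance Definition _ := [Choice of lim by <:].
HB.instance Definition _ := [SubChoice_isSubZmodule of lim by <:].
End Limit.

Section Atoms.
Variable A : nzRingType.
Implicit Types H K M N : lmodType A.

Definition nonzero M (L : submodule M) := exists2 x, x \in L & x != 0.

Record nzsub M := NzSub { nzs :> submodule M; nzsP : nonzero nzs }.
HB.instance Definition _ M := gen_eqMixin (nzsub M).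
HB.instance Definition _ M := gen_choiceMixin (nzsub M).

Definition isomorphic M N := exists f : {linear M -> N}, bijective f.

Definition monoform H : Prop :=
  (exists x : H, x != 0) /\
  forall L' L N : submodule H,
    nonzero L' -> {subset L' <= L} -> ~ {subset L <= L'} -> nonzero N ->
  (* the quotient L / L' *)
  ~ isomorphic (quotmod (preim_submod (smval (L := L)) L')) (submod N).

Definition atom_equiv H K : Prop :=
  exists (L : nzsub H) (N : nzsub K), isomorphic (submod L) (submod N).

(* An atom is the equivalence class, as a predicate on modules, of a monoform
   module. *)
Definition atom H : lmodType A -> Prop :=
  fun K => monoform K /\ atom_equiv H K.

Definition AAss M (alpha : lmodType A -> Prop) : Prop :=
  exists L : submodule M, monoform (submod L) /\ alpha = atom (submod L).

Section ExtAtomMod.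
Variables (n : nat) (H N : lmodType A).
Definition sup_nzsub (L L' : nzsub H) : Prop := {subset L' <= L}.
Definition ext_restr L L' (h : sup_nzsub L L') :
    {additive Ext n (submod L) N -> Ext n (submod L') N} :=
  ext_pull n N (incl h).
(* Ext^n(alpha, N) for the atom alpha with fixed representative H *)
Definition ExtAtomMod : zmodType := colim ext_restr.
End ExtAtomMod.

Fact ext_atom_push_subproof n H N N' (v : {linear N -> N'})
    (L L' : nzsub H) (h : sup_nzsub L L') x :
  ext_push n (submod L') v (ext_restr n N h x) =
  ext_restr n N' h (ext_push n (submod L) v x).
Proof. exact: ext_pull_push. Qed.
Definition ext_atom_push n H N N' (v : {linear N -> N'}) :
    {additive ExtAtomMod n H N -> ExtAtomMod n H N'} :=
  colim_map (@ext_atom_push_subproof n H N N' v).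

Section ExtAtom.
Variables (n : nat) (H K : lmodType A).
Definition sub_nzsub (N N' : nzsub K) : Prop := {subset N <= N'}.
Definition ext_atom_incl (N N' : nzsub K) (h : sub_nzsub N N') :
    {additive ExtAtomMod n H (submod N) -> ExtAtomMod n H (submod N')} :=
  ext_atom_push n H (incl h).
(* Ext^n(alpha, beta) for the atoms alpha, beta with fixed representatives H, K *)
Definition ExtAtom : zmodType := lim ext_atom_incl.
End ExtAtom.

Definition injective_module M : Prop :=
  forall (X Y : lmodType A) (j : {linear X -> Y}) (f : {linear X -> M}),
    injective j -> exists g : {linear Y -> M}, forall x, g (j x) = f x.

Definition injective_envelope H M : Prop :=
  injective_module M /\
  exists2 j : {linear H -> M}, injective j &
    forall L : submodule M, nonzero L ->
      exists2 x : H, x != 0 & j x \in L.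
End Atoms.

Definition noetherian_ring (R : comPzRingType) : Prop :=
  forall I : {pred R}, 0 \in I ->
    {in I &, forall a b, a + b \in I} -> (forall r, {in I, forall a, r * a \in I}) ->
  exists (n : nat) (g : 'I_n -> R), (forall i, g i \in I) /\
    {in I, forall a, exists c : 'I_n -> R, a = \sum_(i < n) c i * g i}.

(* That R is central in Lam is part of the algType structure. *)
Definition noetherian_algebra (R : comPzRingType) (Lam : algType R) : Prop :=
  injective (fun r : R => r%:A : Lam) /\
  exists (n : nat) (g : 'I_n -> Lam),
    forall a, exists c : 'I_n -> R, a = \sum_(i < n) c i *: g i.

Section Primes.
Variables (R : comPzRingType) (Lam : algType R).

Definition two_sided_ideal (I : {pred Lam}) : Prop :=
  zmod_closed I /\ forall a, {in I, forall x, a * x \in I /\ x * a \in I}.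

Definition prime_ideal (P : {pred Lam}) : Prop :=
  [/\ two_sided_ideal P, 1 \notin P &
    forall I J : {pred Lam}, two_sided_ideal I -> two_sided_ideal J ->
      (forall a b, a \in I -> b \in J -> a * b \in P) ->
      {subset I <= P} \/ {subset J <= P}].

Record primeSpec := PrimeSpec {
  prime_pred :> {pred Lam};
  prime_predP : prime_ideal prime_pred
}.

Definition contraction (P : primeSpec) : {pred R} := fun r => r%:A \in prime_pred P.

Fact prime_submod_closed (P : primeSpec) :
  @submod_closed Lam^c (Lam^c)^o (prime_pred P).
Proof.
case: (prime_predP P) => -[[P0 PB] PM] _ _; split=> // a x y Px Py.
have PN (z : Lam) : z \in prime_pred P -> - z \in prime_pred P.
  by move=> Pz; rewrite -[- z]sub0r PB.
rewrite -[a *: x + y]/((x : Lam) * (a : Lam) + (y : Lam)) -[(y : Lam)]opprK.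
by apply: PB; [case: (PM a x Px) | apply: PN].
Qed.
Definition prime_submod (P : primeSpec) : submodule (Lam^c)^o :=
  Submodule (@prime_submod_closed P).

(* IP is an injective envelope I(P) of the atom alpha with AAss(Lam / P) = {alpha},
   where Lam / P is a right Lam-module. *)
Definition is_I_of_prime (P : primeSpec) (IP : lmodType Lam^c) : Prop :=
  exists H : lmodType Lam^c, [/\ monoform H,
    forall alpha, AAss (quotmod (prime_submod P)) alpha <-> alpha = atom H &
    injective_envelope H IP].

(* S(P) = {x in I(P) | x P = 0} *)
Fact annihilated_submod_closed (P : primeSpec) (IP : lmodType Lam^c) :
  @submod_closed Lam^c IP
    [pred x | `[< forall p : Lam^c, p \in prime_pred P -> p *: x = 0 >]].
Proof.
case: (prime_predP P) => -[_ PM] _ _.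
split=> [|a x y /asboolP x0 /asboolP y0]; apply/asboolP => p Pp.
  by rewrite scaler0.
rewrite scalerDr y0 // addr0 scalerA; apply: x0.
exact: (PM (a : Lam) p Pp).1.
Qed.
Definition S_submod (P : primeSpec) (IP : lmodType Lam^c) : submodule IP :=
  Submodule (annihilated_submod_closed P IP).
Definition S_mod (P : primeSpec) (IP : lmodType Lam^c) : lmodType Lam^c :=
  submod (S_submod P IP).
End Primes.

(* phi : Lam -> Lamp is the localization Lam_p at the complement of p in R: elements
   of R outside p become invertible, every element of Lamp is a fraction a / s, and
   phi a = 0 only if a is killed by some s outside p. *)
Definition is_localization (R : comPzRingType) (Lam : algType R)
    (p : {pred R}) (Lamp : nzRingType) (phi : {rmorphism Lam -> Lamp}) : Prop :=
  [/\ forall s : R, s \notin p ->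
        exists u : Lamp, u * phi s%:A = 1 /\ phi s%:A * u = 1,
      forall y : Lamp, exists (a : Lam) (s : R),
        s \notin p /\ y * phi s%:A = phi a &
      forall a : Lam, phi a = 0 -> exists s : R, s \notin p /\ s *: a = 0].

(* N is M with its right Lam-action extended along phi to a right Lamp-action. *)
Definition extends_action (Lam Lamp : nzRingType) (phi : Lam -> Lamp)
    (M : lmodType Lam^c) (N : lmodType Lamp^c) : Prop :=
  exists f : {additive M -> N}, bijective f /\
    forall (a : Lam) (x : M), f ((a : Lam^c) *: x) = (phi a : Lamp^c) *: f x.

Definition group_isomorphic (U V : zmodType) : Prop :=
  exists f : {additive U -> V}, bijective f.

(* Main.v *)
(* Write S = S(P), T = S(Q).  Uniformity of S together with Goldie theory for the
   prime ring Lam / P shows that S / H' is torsion with respect to R \ p for every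
   nonzero H' <= S.

   Ext can be computed from any projective resolution, naturally in the second
   variable.  If u : M -> M' is a localization map (torsion kernel and cokernel,
   M' a module over the localization C), then covering M by a free module and M'
   by the free C-module on the same set gives again a localization map between the
   kernels; iterating, Ext_Lam(M, T) = Ext_C(M', T) whenever T is a C-module.
   Applied to the nonzero submodules of S this makes Ext(H', T) independent of H'.

   Resolving by finitely generated projectives, a cocycle with values in T has, after
   multiplication by a denominator, values in a given nonzero K' <= T.  On the direct
   limit over H' this multiplication is undone by restricting to sH' <= H', so that
   Ext(alpha, K') = Ext(alpha, T) and the inverse limit is constant.

   If some s kills T but acts injectively on S, restriction from H' to sH' is zero;
   if s kills S but is injective on T, the maps from sK' to K' are zero. *)
From HB Require Import structures.
From mathcomp Require Import all_boot all_algebra.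
From mathcomp Require Import generic_quotient ring_quotient boolp functions.
From mathcomp Require Import freeg.
Require Import Defs.
Set Implicit Arguments. Unset Strict Implicit. Unset Printing Implicit Defensive.
Import GRing.Theory.
Local Open Scope ring_scope.
Local Open Scope quotient_scope.

(** * Linear maps: factorization and projectivity *)

Section LinearMaps.
Variable A : nzRingType.
Implicit Types M N X Y F : lmodType A.

Lemma linear_mk M N (h : M -> N) : linear h -> exists h' : {linear M -> N}, h' =1 h.
Proof.
move=> hl; pose m := GRing.isLinear.Build A M N *:%R h hl.
pose h' : {linear M -> N} := HB.pack h m.
by exists h'.
Qed.

Fact hom_linear M N (f : hom M N) : linear (homf f).
Proof. exact: (asboolP _ (homP f)). Qed.
HB.instance Definition _ M N (f : hom M N) :=
  GRing.isLinear.Build A M N *:%R (homf f) (hom_linear f).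

Fact to_hom_subproof M N (f : {linear M -> N}) : (f : M -> N) \in @lin_pred A M N.
Proof. by apply/asboolP => a x y; rewrite linearP. Qed.
Definition to_hom M N (f : {linear M -> N}) : hom M N := Hom (to_hom_subproof f).

Lemma hom_ext M N (f g : hom M N) : f =1 g -> f = g.
Proof. by move=> fg; apply/val_inj/funext. Qed.

Lemma factor_through M X Y (g : {linear X -> Y}) (f : {linear M -> Y}) :
  injective g -> (forall m, exists x, g x = f m) ->
  exists h : {linear M -> X}, forall m, g (h m) = f m.
Proof.
move=> gi /choice[h hP].
have hl : linear h by move=> a x y; apply: gi; rewrite hP !linearP !hP.
by have [h' h'E] := linear_mk hl; exists h' => m; rewrite h'E.
Qed.

Lemma factor_surj M N F (c : {linear F -> M}) (f : {linear F -> N}) :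
  (forall m, exists x, c x = m) -> (forall x, c x = 0 -> f x = 0) ->
  exists h : {linear M -> N}, forall x, h (c x) = f x.
Proof.
move=> cs ck; have [s sP] := choice cs.
have E x y : c x = c y -> f x = f y.
  by move=> /eqP; rewrite -subr_eq0 -raddfB => /eqP/ck/eqP; rewrite raddfB subr_eq0 => /eqP.
have hl : linear (f \o s).
  by move=> a x y; rewrite /= -linearP; apply: E; rewrite linearP !sP.
by have [h' h'E] := linear_mk hl; exists h' => x; rewrite h'E /=; apply: E; rewrite sP.
Qed.

Lemma linear_inverse M N (f : {linear M -> N}) :
  injective f -> (forall y, exists x, f x = y) ->
  exists g : {linear N -> M}, cancel f g /\ cancel g f.
Proof.
move=> fi fs; have [g gP] := factor_through (f := idfun : {linear N -> N}) fi fs.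
by exists g; split=> // x; apply: fi; rewrite gP.
Qed.

(** Lifting is asked along every [g] whose image contains that of [f]. Replacing [Y] by the image of
    [g] shows that this is the usual notion. *)
Definition projective F := forall X Y (g : {linear X -> Y}) (f : {linear F -> Y}),
  (forall z, exists x, g x = f z) -> exists h : {linear F -> X}, forall z, g (h z) = f z.

Lemma freeg_projective (T : choiceType) : projective {freeg T / A}.
Proof.
move=> X Y g f /(_ << _ >>) gf; have [h hP] := choice (fun t : T => gf t).
exists (fglift h); apply: (@freeg_ext A T Y (g \o fglift h) f) => t.
by rewrite /= liftU scale1r hP.
Qed.

End LinearMaps.

Lemma pi_ideal_eq0 (V : zmodType) (B : zmodClosed V) (x : V) :
  \pi_({ideal_quot B}) x = 0 <-> x \in B.
Proof.
rewrite -[x in x \in B]subr0 -(raddf0 (\pi_({ideal_quot B}))) Quotient.idealrBE.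
by split=> /eqP.
Qed.

(** * Ext classes as classes of maps on syzygies *)

Section ExtClass.
Variable A : nzRingType.
Implicit Types M N : lmodType A.

Fact class_cocycle_subproof n M N (f : hom (syz n M) N) :
  precomp (aug (syz n M)) f \in @cocycle_pred A n M N.
Proof.
apply/eqP/hom_ext => x /=; rewrite (eqP (smvalP (aug (syz n.+1 M) x))).
exact: raddf0.
Qed.
Definition class_cocycle n M N (f : hom (syz n M) N) : cocycle n M N :=
  Cocycle (class_cocycle_subproof f).

(** Composition with the surjection [aug] turns maps on the n-th syzygy into cocycles and presents
    Ext as a quotient of [hom (syz n M) N]. *)
Definition ext_class n M N (f : hom (syz n M) N) : Ext n M N :=
  \pi_({ideal_quot (@coboundary_pred A n M N)}) (class_cocycle f).

Fact ext_class_zmod n M N : zmod_morphism (@ext_class n M N).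
Proof.
move=> f g; rewrite /ext_class -[RHS]raddfB; congr (\pi _).
exact/val_inj/val_inj.
Qed.
HB.instance Definition _ n M N := GRing.isZmodMorphism.Build
  (hom (syz n M) N) (Ext n M N) (@ext_class n M N) (@ext_class_zmod n M N).

(** A cocycle vanishes on the image of [dres], which is the kernel of [aug], and so descends to the
    syzygy. *)
Lemma ext_class_surj n M N (c : Ext n M N) : exists f, c = ext_class f.
Proof.
rewrite -[c]reprK; set z := repr _.
have zk x : aug (syz n M) x = 0 -> cochain z x = 0.
  move=> x0.
  have x0' : x \in kernel (aug (syz n M)) by apply/eqP.
  have /eqP/(congr1 (fun h : hom _ _ => h << SubMod x0' >>)) := cocycleP z.
  by rewrite /= liftU scale1r.
have [h hP] := factor_surj (f := cochain z) (@aug_surj A (syz n M)) zk.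
exists (to_hom h); rewrite /ext_class; congr (\pi _).
by apply/val_inj/hom_ext => x /=; rewrite hP.
Qed.

(** The surjection [aug] can be cancelled from the coboundary equation; what remains is an extension
    of [f] from the syzygy to the free module around it. *)
Lemma ext_class_eq0 n M N (f : hom (syz n M) N) :
  ext_class f = 0 <->
  (if n is k.+1 return hom (syz n M) N -> Prop
   then fun f => exists g : hom (res k M) N, forall z, f z = g (smval z)
   else fun f => f = 0) f.
Proof.
have -> : ext_class f = 0 <-> class_cocycle f \in @coboundary_pred A n M N.
  exact: pi_ideal_eq0.
case: n f => [|n] f /=; rewrite unfold_in /=.
  split=> [/eqP/(congr1 (fun c => cochain c)) e|->]; last by apply/eqP/val_inj/hom_ext.
  apply/hom_ext => x.
  by have := congr1 (fun h : hom _ _ => h << x >>) e; rewrite /= liftU scale1r.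
split=> [/asboolP[g gP]|[g gP]]; last first.
  by apply/asboolP; exists g; apply/hom_ext => x /=; rewrite gP.
exists g => z; have := congr1 (fun h : hom _ _ => h << z >>) gP.
by rewrite /= !liftU !scale1r.
Qed.

Lemma ext_pull_class n M M' N (u : {linear M -> M'}) (f : hom (syz n M') N) :
  ext_pull n N u (ext_class f) = ext_class (precomp (syzmap n u) f).
Proof.
rewrite /ext_class /= quotmap_pi; congr (\pi _).
by apply/val_inj/hom_ext => x /=; rewrite aug_nat.
Qed.

Lemma ext_push_class n M N N' (v : {linear N -> N'}) (f : hom (syz n M) N) :
  ext_push n M v (ext_class f) = ext_class (postcomp v f).
Proof.
rewrite /ext_class /= quotmap_pi; congr (\pi _).
exact/val_inj/val_inj.
Qed.

End ExtClass.

(** * Projective resolutions *)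

Section Resolutions.
Variable A : nzRingType.
Implicit Types M N : lmodType A.

(** A projective resolution of [rsyz 0], cut into short exact sequences 0 -> rsyz (n+1) -> rprj n ->
    rsyz n -> 0. *)
Record resolution := Resolution {
  rsyz : nat -> lmodType A;
  rprj : nat -> lmodType A;
  rcov : forall n, {linear rprj n -> rsyz n};
  remb : forall n, {linear rsyz n.+1 -> rprj n};
  rprjP : forall n, projective (rprj n);
  rcov_surj : forall n z, exists y, rcov n y = z;
  remb_inj : forall n, injective (remb n);
  rexact : forall n y, rcov n y = 0 <-> exists z, remb n z = y
}.
Implicit Types X Y W : resolution.

Lemma rcov_emb X n z : rcov X n (remb X n z) = 0.
Proof. by apply/rexact; exists z. Qed.

(** [b] is the map on n-th syzygies of some chain map over [a]. This is a relation because the chain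
    map is unique only up to homotopy. *)
Fixpoint lifts X Y (a : {linear rsyz X 0 -> rsyz Y 0}) n :
    {linear rsyz X n -> rsyz Y n} -> Prop :=
  if n is n'.+1 then fun b => exists (b' : {linear rsyz X n' -> rsyz Y n'})
      (B : {linear rprj X n' -> rprj Y n'}),
    [/\ lifts a b', forall y, rcov Y n' (B y) = b' (rcov X n' y) &
        forall z, remb Y n' (b z) = B (remb X n' z)]
  else fun b => b =1 a.

Lemma lifts_exist X Y a n : exists b, @lifts X Y a n b.
Proof.
elim: n => [|n [b bP]]; first by exists a.
have [B BP] := rprjP (f := b \o rcov X n) (fun z => rcov_surj (b (rcov X n z))).
have [z|c cP] := @factor_through _ _ _ _ (remb Y n) (B \o remb X n) (@remb_inj Y n).
  by apply/rexact; rewrite /= BP /= rcov_emb linear0.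
by exists c, b, B; split.
Qed.

Lemma lifts_id X n : lifts (idfun : {linear rsyz X 0 -> rsyz X 0}) (idfun : {linear
  rsyz X n -> rsyz X n}).
Proof. by elim: n => // n IH; exists idfun, idfun. Qed.

Lemma lifts_ext X Y (a a' : {linear rsyz X 0 -> rsyz Y 0}) n b :
  a =1 a' -> lifts (n := n) a b -> lifts a' b.
Proof.
move=> aE; elim: n b => [|n IH] b /=; first by move=> ba x; rewrite ba aE.
by move=> [b' [B [/IH ? ? ?]]]; exists b', B.
Qed.

Lemma lifts_comp X Y W (a : {linear rsyz X 0 -> rsyz Y 0})
    (a' : {linear rsyz Y 0 -> rsyz W 0}) n b b' :
  lifts a b -> lifts a' b' -> lifts (n := n) (a' \o a) (b' \o b).
Proof.
elim: n b b' => [|n IH] b b' /=; first by move=> ba b'a' x; rewrite /= b'a' ba.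
move=> [c [B [cP Bc Bb]]] [c' [B' [c'P B'c B'b]]].
exists (c' \o c), (B' \o B); split=> [|y|z] /=; first exact: IH.
  by rewrite B'c Bc.
by rewrite B'b Bb.
Qed.

(* The maps that represent 0 in Ext^n. *)
Definition extendable X n N : (rsyz X n -> N) -> Prop :=
  if n is k.+1 return (rsyz X n -> N) -> Prop then
    fun f => exists g : {linear rprj X k -> N}, forall z, f z = g (remb X k z)
  else fun f => forall z, f z = 0.

(** Two chain maps over [a] are homotopic. The homotopy is built along the induction, as the
    extension of the difference to the projective module. *)
Lemma lifts_unique X Y (a : {linear rsyz X 0 -> rsyz Y 0}) n b c :
  lifts a b -> lifts a c -> extendable (n := n) (b \- c).
Proof.
elim: n b c => [|n IH] b c /=; first by move=> ba ca z; rewrite /= ba ca subrr.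
move=> [b' [B [b'P Bc Bb]]] [c' [C [c'P Cc Cb]]].
have := IH _ _ b'P c'P.
have factor (D : {linear rprj X n -> rprj Y n}) : (forall y, rcov Y n (D y) = 0) ->
    exists h : {linear rprj X n -> rsyz Y n.+1}, forall y, remb Y n (h y) = D y.
  by move=> D0; apply: (factor_through (@remb_inj Y n)) => y; apply/rexact.
case: n => [|n] in b c IH b' B b'P Bc Bb c' C c'P Cc Cb factor *.
  move=> bc; have [y|h hP] := factor (B \- C).
    by rewrite /= linearB Bc Cc -[LHS]/((b' \- c') _) bc.
  by exists h => z; apply: (@remb_inj Y 0); rewrite hP /= linearB Bb Cb.
move=> [h hP].
(* [k] lifts the extension found one degree lower. Subtracting its contribution from [B - C] gives a
   map into the kernel of [rcov]; on the syzygy this still agrees with [B - C], since [rcov] after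
   [remb] is zero. *)
have [k kP] := rprjP (f := h) (fun z => rcov_surj (h z)).
have [y|l lP] := factor (B \- C \- (k \o remb X n \o rcov X n.+1)).
  by rewrite /= !linearB /= Bc Cc kP -hP /= subrr.
exists l => z; apply: (@remb_inj Y n.+1).
by rewrite lP /= rcov_emb !linear0 addr0 linearB Bb Cb.
Qed.

Fact syz_emb_exact n M (y : res n M) :
  aug (syz n M) y = 0 <-> exists z : syz n.+1 M, smval z = y.
Proof.
split=> [/eqP y0|[z <-]]; first by exists (SubMod (y0 : y \in kernel (aug (syz n M)))).
exact: (eqP (smvalP z)).
Qed.

Definition stdres M : resolution :=
  @Resolution (fun n => syz n M) (fun n => res n M) (fun n => aug (syz n M))
    (fun n => smval (L := kernel (aug (syz n M))))
    (fun n => @freeg_projective A _) (fun n => @aug_surj A (syz n M))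
    (fun n => val_inj) (fun n => @syz_emb_exact n M).

Lemma syzmap_lifts n M M' (u : {linear M -> M'}) :
  lifts (X := stdres M) (Y := stdres M') u (syzmap n u).
Proof.
elim: n => //= n IH; exists (syzmap n u), (resmap n u); split=> // y.
exact: aug_nat.
Qed.

Lemma ext_class_eq0P n M N (f : hom (syz n M) N) :
  ext_class f = 0 <-> extendable (X := stdres M) f.
Proof.
rewrite ext_class_eq0; case: n f => [|n] f /=.
  by split=> [-> //|f0]; apply: hom_ext.
by split=> -[g gP]; [exists g | exists (to_hom g)].
Qed.

Lemma extendable_comp X n N N' (v : {linear N -> N'}) (f : rsyz X n -> N) :
  extendable f -> extendable (v \o f).
Proof.
case: n f => [|n] f /= => [f0 z|[g gP]]; first by rewrite /= f0 linear0.
by exists (v \o g) => z; rewrite /= gP.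
Qed.

Lemma extendableD X n N (f g : rsyz X n -> N) :
  extendable f -> extendable g -> extendable (f \+ g).
Proof.
case: n f g => [|n] f g /= => [f0 g0 z|[f' f'P] [g' g'P]]; first by rewrite /= f0 g0 addr0.
by exists (f' \+ g') => z; rewrite /= f'P g'P.
Qed.

Lemma extendable_lift X Y (a : {linear rsyz X 0 -> rsyz Y 0}) n b N
    (f : rsyz Y n -> N) :
  lifts a b -> extendable f -> extendable (f \o b).
Proof.
case: n b f => [|n] b f /= => [_ f0 z|[b' [B [_ _ Bb]]] [g gP]]; first exact: f0.
by exists (g \o B) => z; rewrite /= gP Bb.
Qed.

Lemma extendable_eq X n N (f g : rsyz X n -> N) :
  f =1 g -> extendable f -> extendable g.
Proof. by move=> /funext ->. Qed.

(* [b] is chosen before [N], which makes the description natural in [N]. *)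
Lemma ext_resolution X n :
  exists b : {linear syz n (rsyz X 0) -> rsyz X n}, forall N,
    (forall c : Ext n (rsyz X 0) N,
       exists f : hom (rsyz X n) N, c = ext_class (precomp b f)) /\
    (forall f : hom (rsyz X n) N, ext_class (precomp b f) = 0 <-> extendable f).
Proof.
set M := rsyz X 0; pose i : {linear M -> M} := idfun.
have [b bP] := @lifts_exist (stdres M) X i n.
have [c cP] := @lifts_exist X (stdres M) i n.
(* Both composites of [b] and [c] lift the identity, so they differ from it by extendable maps: [b]
   and [c] are mutually inverse on Ext. *)
have cb : extendable ((c \o b : {linear _ -> _}) \- (idfun : {linear syz n M -> _})).
  apply: (@lifts_unique (stdres M) (stdres M) i); last exact: lifts_id.
  exact: lifts_ext (lifts_comp bP cP).
have bc : extendable ((b \o c : {linear _ -> _}) \- (idfun : {linear rsyz X n -> _})).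
  apply: (@lifts_unique X X i); last exact: lifts_id.
  exact: lifts_ext (lifts_comp cP bP).
exists b => N; split=> [d | f].
  have [g ->] := ext_class_surj d; exists (precomp c g).
  apply/eqP; rewrite eq_sym -subr_eq0 -raddfB; apply/eqP/ext_class_eq0P.
  by apply: extendable_eq (extendable_comp g cb) => z /=; rewrite linearB.
rewrite ext_class_eq0P; split=> [fb|]; last exact: (@extendable_lift (stdres M) X i).
have fbc := extendable_lift (X := X) (Y := stdres M) cP fb.
have := extendableD fbc (extendable_comp (\- f) bc); apply: extendable_eq => z /=.
by rewrite linearB opprB addrC subrK.
Qed.

(** * Multiplication by a central element *)

Section Central.
Variables (s : A) (sC : forall a, s * a = a * s).

Fact smul_linear M : linear (fun x : M => s *: x).
Proof. by move=> a x y; rewrite scalerDr !scalerA sC. Qed.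
Definition smul M : {linear M -> M} :=
  HB.pack_for {linear M -> M} (fun x : M => s *: x)
    (GRing.isLinear.Build A M M *:%R (fun x : M => s *: x) (@smul_linear M)).

Lemma smul_lifts X n : lifts (smul (rsyz X 0)) (smul (rsyz X n)).
Proof.
elim: n => // n IH; exists (smul (rsyz X n)), (smul (rprj X n)).
by split=> // y; rewrite /= linearZ.
Qed.

(** Multiplication by s on the whole resolution lifts multiplication by s on M, and on the level of
    maps to N it is multiplication by s on the values. *)
Lemma ext_pull_smul n M N (c : Ext n M N) :
  ext_pull n N (smul M) c = ext_push n M (smul N) c.
Proof.
have [f ->] := ext_class_surj c; rewrite ext_pull_class ext_push_class.
apply/eqP; rewrite -subr_eq0 -raddfB; apply/eqP/ext_class_eq0P.
have := lifts_unique (syzmap_lifts n (smul M)) (smul_lifts (stdres M) n).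
move=> /(extendable_comp f); apply: extendable_eq => z /=.
by rewrite linearB linearZ.
Qed.
End Central.

(** The composite of the syzygy maps and the syzygy map of [w] lift the same map, hence differ by an
    extendable one. A separate [w] admits composites that agree only pointwise. *)
Lemma ext_pull_comp n M M' M'' N (u : {linear M -> M'}) (v : {linear M' -> M''})
    (w : {linear M -> M''}) c :
  (forall x, w x = v (u x)) -> ext_pull n N u (ext_pull n N v c) = ext_pull n N w c.
Proof.
move=> wE; have [f ->] := ext_class_surj c; rewrite !ext_pull_class.
apply/eqP; rewrite -subr_eq0 -raddfB; apply/eqP/ext_class_eq0P.
have vu := lifts_comp (syzmap_lifts n u) (syzmap_lifts n v).
have : lifts (X := stdres M) (Y := stdres M'') (v \o u) (syzmap n w).
  exact: lifts_ext (syzmap_lifts n w).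
move=> /(lifts_unique vu)/(extendable_comp f); apply: extendable_eq => z /=.
by rewrite linearB.
Qed.

Lemma ext_push_comp n M N N' N'' (u : {linear N -> N'}) (v : {linear N' -> N''})
    (w : {linear N -> N''}) c :
  (forall x, w x = v (u x)) -> ext_push n M v (ext_push n M u c) = ext_push n M w c.
Proof.
move=> wE; have [f ->] := ext_class_surj c; rewrite !ext_push_class.
by congr ext_class; apply: hom_ext => x /=.
Qed.

Lemma ext_push_id n M N (u : {linear N -> N}) (c : Ext n M N) :
  u =1 id -> ext_push n M u c = c.
Proof.
move=> uE; have [f ->] := ext_class_surj c; rewrite !ext_push_class.
by congr ext_class; apply: hom_ext => x /=.
Qed.

End Resolutions.

(** * Localization *)
Section AdditiveMaps.
Implicit Types U V W : zmodType.

Lemma additive_mk U V (h : U -> V) :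
  {morph h : x y / x - y} -> exists h' : {additive U -> V}, h' =1 h.
Proof.
move=> hB; pose m := GRing.isZmodMorphism.Build U V h hB.
pose h' : {additive U -> V} := HB.pack h m.
by exists h'.
Qed.

(** First isomorphism theorem, for two Ext groups presented as quotients of one group of
    homomorphisms. *)
Lemma group_isomorphic_quot V U W (f : {additive V -> U}) (g : {additive V -> W}) :
  (forall u, exists x, u = f x) -> (forall w, exists x, w = g x) ->
  (forall x, f x = 0 <-> g x = 0) -> group_isomorphic U W.
Proof.
move=> /choice[s sP] /choice[t tP] fg.
have fgE x y : f x = f y <-> g x = g y.
  split=> /eqP; rewrite -subr_eq0 -raddfB => /eqP/fg/eqP.
    by rewrite raddfB subr_eq0 => /eqP.
  by rewrite raddfB subr_eq0 => /eqP.
have [|h hE] := @additive_mk U W (g \o s).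
  by move=> x y; rewrite /= -raddfB; apply/fgE; rewrite raddfB -!sP.
exists h; exists (f \o t) => x; rewrite hE /=.
  by rewrite [RHS]sP; apply/fgE; rewrite -tP.
by rewrite [RHS]tP; apply/fgE; rewrite -sP.
Qed.

Lemma bijective_of U V (f : {additive U -> V}) :
  (forall x, f x = 0 -> x = 0) -> (forall y, exists x, f x = y) -> bijective f.
Proof.
move=> f0 /choice[s sP].
have fi : injective f by apply: raddf_inj.
by exists s => // x; apply: fi; rewrite sP.
Qed.

Lemma group_isomorphic_trans U V W :
  group_isomorphic U V -> group_isomorphic V W -> group_isomorphic U W.
Proof. by move=> [f fb] [g gb]; exists (g \o f); apply: bij_comp. Qed.

Lemma group_isomorphic_sym U V : group_isomorphic U V -> group_isomorphic V U.
Proof.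
move=> [f [g fg gf]]; have [|g' g'E] := @additive_mk V U g.
  by move=> x y; apply: (can_inj fg); rewrite gf raddfB !gf.
by exists g'; exists f => x; rewrite g'E ?fg ?gf.
Qed.
End AdditiveMaps.

(** Restriction of scalars along [phi]. An alias of the carrier keeps the two module structures
    apart. *)
Definition resc (B : pzRingType) (C : nzRingType) (phi : {rmorphism B ->
  C}) (N : lmodType C) : Type := N.

Section RestrictionOfScalars.
Variables (B : pzRingType) (C : nzRingType) (phi : {rmorphism B -> C}) (N : lmodType C).

HB.instance Definition _ := GRing.Zmodule.on (resc phi N).
Definition resc_scale (b : B) (x : resc phi N) : resc phi N := phi b *: (x : N).
Fact resc_scaleA a b x : resc_scale a (resc_scale b x) = resc_scale (a * b) x.
Proof. by rewrite /resc_scale rmorphM scalerA. Qed.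
Fact resc_scale1 : left_id 1 resc_scale.
Proof. by move=> x; rewrite /resc_scale rmorph1 scale1r. Qed.
Fact resc_scaleDr : right_distributive resc_scale +%R.
Proof. by move=> a x y; apply: scalerDr. Qed.
Fact resc_scaleDl x : {morph resc_scale^~ x : a b / a + b}.
Proof. by move=> a b; rewrite /resc_scale rmorphD scalerDl. Qed.
HB.instance Definition _ := GRing.Zmodule_isLmodule.Build B (resc phi N)
  resc_scaleA resc_scale1 resc_scaleDr resc_scaleDl.

Lemma rescE (b : B) (x : resc phi N) : b *: x = phi b *: (x : N) :> N.
Proof. by []. Qed.
End RestrictionOfScalars.

(** * Localization at a central multiplicative set, and change of rings for Ext *)

Section Localization.
Variables (B C : nzRingType) (phi : {rmorphism B -> C}) (D : B -> Prop).
Hypothesis D1 : D 1.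
Hypothesis DM : forall s t, D s -> D t -> D (s * t).
Hypothesis DC : forall s, D s -> forall a, s * a = a * s.
Hypothesis phi_inv : forall s, D s -> exists u, u * phi s = 1 /\ phi s * u = 1.
Hypothesis phi_frac : forall c, exists s b, D s /\ phi s * c = phi b.
Hypothesis phi_ker : forall b, phi b = 0 -> exists2 s, D s & s * b = 0.

Implicit Types (M : lmodType B) (N : lmodType C) (T : choiceType).

(** Torsion kernel and torsion cokernel. As D acts invertibly on the [C]-module N, such a [u]
    exhibits N as the localization of M. *)
Definition localization_map M N
    (u : {linear M -> resc phi N}) : Prop :=
  (forall x, u x = 0 -> exists2 s, D s & s *: x = 0) /\
  (forall y : N, exists s x, D s /\ phi s *: y = u x).

Lemma den_inj (N : lmodType C) s (x y : N) : D s -> phi s *: x = phi s *: y -> x = y.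
Proof.
move=> /phi_inv[u [us _]] /(congr1 ( *:%R u)).
by rewrite !scalerA us !scale1r.
Qed.

Lemma den_surj (N : lmodType C) s (x : N) : D s -> exists y, phi s *: y = x.
Proof.
by move=> /phi_inv[u [_ su]]; exists (u *: x); rewrite scalerA su scale1r.
Qed.

(** The universal property: [h] sends the fraction x / s in N to g x / s in N', and is defined
    through its graph. *)
Lemma localization_map_lift M N N' (u : {linear M -> resc phi N})
    (g : {linear M -> resc phi N'}) :
  localization_map u -> exists h : {linear N -> N'}, forall x, h (u x) = g x.
Proof.
move=> [uk uc].
pose graph (y : N) (z : N') :=
  exists s x, [/\ D s, phi s *: y = u x & phi s *: z = g x].
have uZ b x : u (b *: x) = phi b *: (u x : N) by rewrite linearZ.
have gZ b x : g (b *: x) = phi b *: (g x : N') by rewrite linearZ.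
have graph_ex y : exists z, graph y z.
  have [s [x [Ds yx]]] := uc y; have [z zx] := den_surj (g x : N') Ds.
  by exists z, s, x.
(* Two fractions for the same y are cross-multiplied; their difference dies under [u], so it is
   killed by some r in D before [g] is applied. *)
have graph_uniq y z z' : graph y z -> graph y z' -> z = z'.
  move=> [s [x [Ds yx zx]]] [t [x' [Dt yx' zx']]].
  have ux0 : u (t *: x - s *: x') = 0.
    rewrite linearB; apply/eqP; rewrite subr_eq0; apply/eqP.
    by rewrite !uZ -yx -yx' !scalerA -!rmorphM (DC Ds).
  have [r Dr /eqP] := uk _ ux0; rewrite scalerBr !scalerA subr_eq0 => /eqP/(congr1 g).
  rewrite !gZ -zx -zx' !scalerA -!rmorphM -!mulrA (DC Ds) => e.
  by apply: den_inj e; apply: DM => //; apply: DM.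
have [h hP] := choice graph_ex.
have hl : linear h.
  move=> c y1 y2; apply: graph_uniq (hP _) _.
  have [s [x [Ds yx zx]]] := hP y1; have [t [x' [Dt yx' zx']]] := hP y2.
  have [r [b [Dr rb]]] := phi_frac c.
  (* A common denominator for y1, y2 and the scalar c, with the numerator it produces. *)
  exists (t * s * r), (t *: (b *: x) + (r * s) *: x').
  have tsr (P : lmodType C) (p q p' : P) : phi s *: p = p' ->
      phi (t * s * r) *: (c *: p + q) = phi t *: (phi b *: p') + phi (r * s) *: (phi t *: q).
    have e1 : phi (t * s * r) * c = phi t * (phi b * phi s).
      by rewrite -mulrA (rmorphM phi) -mulrA rmorphM -mulrA rb -!rmorphM (DC Ds).
    have e2 : t * s * r = r * s * t by rewrite -mulrA (DC Dt) (DC Ds).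
    by move=> <-; rewrite scalerDr !scalerA e1 e2 (rmorphM phi (r * s)) !mulrA.
  split; first by apply: DM => //; apply: DM.
    by rewrite (tsr _ _ _ _ yx) yx' linearD !uZ.
  by rewrite (tsr _ _ _ _ zx) zx' linearD !gZ.
have [h' h'E] := linear_mk hl; exists h' => x; rewrite h'E.
apply: graph_uniq (hP _) _; exists 1, x.
by split=> //; rewrite rmorph1 scale1r.
Qed.

Lemma localization_map_ext M N N' (u : {linear M -> resc phi N})
    (h h' : {linear N -> N'}) :
  localization_map u -> (forall x, h (u x) = h' (u x)) -> h =1 h'.
Proof.
move=> [_ uc] hh' y; have [s [x [Ds yx]]] := uc y.
by apply: (den_inj Ds); rewrite -!linearZ yx.
Qed.

Definition freeloc (T : choiceType) : {linear {freeg T / B} -> resc phi {freeg T / C}} :=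
  fglift (fun t => << t >> : resc phi {freeg T / C}).

Lemma coeff_freeloc T t (d : {freeg T / B}) :
  coeff t (freeloc T d : {freeg T / C}) = phi (coeff t d).
Proof.
elim/freeg_ind_dom0: d => [|c x d _ _ IH]; first by rewrite linear0 !coeff0 rmorph0.
rewrite linearD !coeffD IH rmorphD; congr (_ + _).
by rewrite /= liftU rescE coeffZ !coeffU rmorphM rmorph_nat mul1r.
Qed.

Lemma common_den (I : eqType) (r : seq I) (Q : I -> B -> Prop) :
  (forall i s t, D s -> Q i t -> Q i (s * t)) ->
  (forall i, exists2 s, D s & Q i s) -> exists2 s, D s & {in r, forall i, Q i s}.
Proof.
move=> QM Qex; elim: r => [|i r [s Ds sP]]; first by exists 1.
have [t Dt tP] := Qex i; exists (s * t); first exact: DM.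
move=> j; rewrite inE => /predU1P[->|jr]; first exact: QM.
by rewrite (DC Ds); apply: QM => //; apply: sP.
Qed.

(** Elements of a free module have finite support, so one denominator serves all coefficients. *)
Lemma freeloc_localization_map T : localization_map (freeloc T).
Proof.
split=> [d d0 | e].
  have [i s t Ds st|i|s Ds sP] := @common_den T (dom d) (fun t s => s * coeff t d = 0).
  - by rewrite -mulrA st mulr0.
  - by apply: phi_ker; rewrite -coeff_freeloc d0 coeff0.
  exists s => //; apply/eqP/freeg_eqP => t; rewrite coeffZ coeff0.
  have [/sP //|/coeff_outdom ->] := boolP (t \in dom d); exact: mulr0.
elim/freeg_ind_dom0: e => [|c t e _ _ [s [d [Ds sd]]]].
  by exists 1, 0; rewrite scaler0 linear0.
have [r [b [Dr rb]]] := phi_frac c.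
exists (s * r), (s *: << b *g t >> + r *: d); split; first exact: DM.
rewrite scalerDr linearD !linearZ_LR /= !rescE -sd !scalerA -!rmorphM (DC Ds r); congr (_ + _).
rewrite liftU rescE -(DC Ds r) rmorphM -!scalerA; congr (_ *: _).
by apply/eqP/freeg_eqP => x; rewrite !coeffZ !coeffU mul1r mulrA rb.
Qed.

(** * A resolution localized step by step *)

Section LocalizedResolution.
Variables (M0 : lmodType B) (N0 : lmodType C) (u0 : {linear M0 -> resc phi N0}).
Hypothesis u0P : localization_map u0.

Record localized M := Localized {
  loc_mod : lmodType C;
  loc_map : {linear M -> resc phi loc_mod};
  loc_mapP : localization_map loc_map
}.

(** The free [C]-module on the same basis as the free cover [aug] of M, so that [freeloc] compares
    the two covers. *)
Definition loc_cov M (L : localized M) : {linear {freeg M / C} -> loc_mod L} :=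
  fglift (fun x : M => loc_map L x : loc_mod L).

Lemma loc_cov_freeloc M (L : localized M) d : loc_cov L (freeloc M d) = loc_map L (aug M d).
Proof.
elim/freeg_ind_dom0: d => [|c x d _ _ IH]; first by rewrite !linear0.
rewrite !linearD IH; congr (_ + _).
by rewrite /= !liftU rescE linearZ_LR /= liftU scale1r linearZ_LR.
Qed.

Lemma loc_cov_surj M (L : localized M) y : exists d, loc_cov L d = y.
Proof.
have [s [x [Ds yx]]] := (loc_mapP L).2 y; have [u [us _]] := phi_inv Ds.
by exists (u *: << x >>); rewrite linearZ_LR /= liftU scale1r -yx scalerA us scale1r.
Qed.

(** [freeloc] restricts to the kernels of the two covers and remains a localization map there, which
    lets the construction be iterated. *)
Lemma loc_kernel_exists M (L : localized M) :
  exists v : {linear submod (kernel (aug M)) -> resc phi (submod (kernel (loc_cov L)))},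
    localization_map v /\ forall z, smval (v z) = freeloc M (smval z) :> {freeg M / C}.
Proof.
have k0 (z : submod (kernel (aug M))) : (freeloc M (smval z) : {freeg M / C}) \in kernel (loc_cov L).
  by apply/eqP; rewrite loc_cov_freeloc (eqP (smvalP z)) linear0.
pose w z : resc phi (submod (kernel (loc_cov L))) := SubMod (k0 z).
have wl : linear w.
  by move=> a x y; apply: val_inj; rewrite /= linearP.
have [v vE] := linear_mk wl; exists v; split; last by move=> z; rewrite vE.
have [fk fc] := freeloc_localization_map M; split=> [z|e].
  rewrite vE => /(congr1 (fun e => smval e))/= /fk[s Ds sz].
  by exists s => //; apply: val_inj.
have [s [d [Ds sd]]] := fc (smval e).
(* The numerator [d] need not lie in the kernel of [aug], but its image in M is torsion; multiplying
   by t brings it there. *)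
have /(loc_mapP L).1[t Dt td] : loc_map L (aug M d) = 0.
  by rewrite -loc_cov_freeloc -sd linearZ_LR /= (eqP (smvalP e)) scaler0.
have td0 : t *: d \in kernel (aug M) by apply/eqP; rewrite linearZ_LR.
exists (t * s), (SubMod td0); split; first exact: DM.
by apply: val_inj; rewrite vE /= rmorphM -scalerA sd linearZ_LR.
Qed.

Definition loc_kernel M (L : localized M) : localized (submod (kernel (aug M))) :=
  Localized (svalP (cid (loc_kernel_exists L))).1.

Lemma loc_kernel_emb M (L : localized M) z :
  smval (loc_map (loc_kernel L) z : submod (kernel (loc_cov L))) = freeloc M (smval z).
Proof. exact: (svalP (cid (loc_kernel_exists L))).2. Qed.

Fixpoint loc_syz n : localized (syz n M0) :=
  if n is k.+1 return localized (syz n M0) then loc_kernel (loc_syz k) else Localized u0P.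

Fact loc_syz_exact n (y : {freeg (syz n M0) / C}) :
  loc_cov (loc_syz n) y = 0 <-> exists z : loc_mod (loc_syz n.+1), smval z = y.
Proof.
split=> [/eqP y0|[z <-]]; last exact: (eqP (smvalP z)).
by exists (SubMod (y0 : y \in kernel (loc_cov (loc_syz n)))).
Qed.

Definition locres : resolution C :=
  @Resolution C (fun n => loc_mod (loc_syz n)) (fun n => {freeg (syz n M0) / C})
    (fun n => loc_cov (loc_syz n)) (fun n => smval (L := kernel (loc_cov (loc_syz n))))
    (fun n => @freeg_projective C _) (fun n => @loc_cov_surj _ (loc_syz n))
    (fun n => val_inj) loc_syz_exact.

Variables (T : lmodType B) (N : lmodType C) (w : {linear T -> resc phi N}).
Hypothesis w_bij : bijective w.

(** T is a [C]-module through [w], so maps from M to T are the same as [C]-linear maps from the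
    localization of M, by the universal property. *)
Lemma hom_localized M (L : localized M) :
  exists F : {additive hom M T -> hom (loc_mod L) N},
    (forall f x, F f (loc_map L x) = w (f x)) /\ bijective F.
Proof.
have [h hP] := choice (fun f : hom M T => localization_map_lift (w \o f) (loc_mapP L)).
have [f g|F FE] := @additive_mk _ _ (fun f => to_hom (h f)).
  apply: hom_ext; apply: (localization_map_ext (loc_mapP L)) => x /=.
  by rewrite -[RHS]/(h f (loc_map L x) - h g (loc_map L x)) !hP /= -linearB.
exists F; have FP f x : F f (loc_map L x) = w (f x) by rewrite FE /= hP.
split=> //; apply: bijective_of => [f f0 | g].
  by apply: hom_ext => x; apply: (bij_inj w_bij); rewrite -FP f0 linear0.
have [w' wK w'K] := w_bij.
have w'l : linear (fun x => w' (g (loc_map L x))).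
  by move=> a x y; apply: (bij_inj w_bij); rewrite w'K linearP [in RHS]linearP !w'K;
    apply: (linearP g (phi a)).
have [f fE] := linear_mk w'l; exists (to_hom f); apply: hom_ext.
by apply: (localization_map_ext (loc_mapP L)) => x /=; rewrite FP /= fE w'K.
Qed.

(** Both groups are quotients of [hom (syz n M0) T], the second one through the localized
    resolution; it remains to see that the same maps are extendable on both sides. *)
Lemma ext_localization n : group_isomorphic (Ext n M0 T) (Ext n N0 N).
Proof.
have [F [FP Fb]] := hom_localized (loc_syz n).
have [b /(_ N)[b_surj b0]] := ext_resolution locres n.
apply: (@group_isomorphic_quot _ _ _ (@ext_class B n M0 T)
  (@ext_class C n N0 N \o precomp b \o F)) => [c|c|f].
- exact: ext_class_surj.
- have [g ->] := b_surj c; have [F' _ F'K] := Fb.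
  by exists (F' g); rewrite /= F'K.
rewrite ext_class_eq0P /= b0.
case: n => [|n] in F FP Fb b b_surj b0 f *.
  split=> /= f0.
    by move=> z; apply: (localization_map_ext (h' := \0) (loc_mapP (loc_syz 0))) z => x /=;
      rewrite FP f0 linear0.
  by move=> x; apply: (bij_inj w_bij); rewrite -FP f0 linear0.
have [G [GP Gb]] := hom_localized (Localized (freeloc_localization_map (syz n M0))).
(* Extensions correspond under localization: two maps on a localized module agree as soon as they
   agree on the image of [loc_map]. *)
have FG (g : hom (res n M0) T) : (forall z, f z = g (smval z)) <->
    (forall z : loc_mod (loc_syz n.+1), F f z = G g (smval z)).
  split=> e.
    pose h' : {linear loc_mod (loc_syz n.+1) -> N} := G g \o smval (L := kernel (loc_cov (loc_syz n))).
    by apply: (localization_map_ext (h' := h') (loc_mapP (loc_syz n.+1))) => z /=;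
      rewrite FP e loc_kernel_emb GP.
  by move=> z; apply: (bij_inj w_bij); rewrite -FP e /= loc_kernel_emb GP.
split=> /= -[g gP].
  by exists (G (to_hom g)); apply/FG.
have [G' _ G'K] := Gb; exists (G' (to_hom g)); apply/FG.
by rewrite G'K.
Qed.
End LocalizedResolution.

End Localization.

(** * Finitely generated modules *)
Section Span.
Variables (A : pzRingType) (M : lmodType A).
Implicit Types (s t : seq M) (x y : M).

(** Membership in the submodule generated by [s], peeling off one generator at a time so that
    inductions on [s] need no families of coefficients. *)
Fixpoint span s x : Prop :=
  if s is g :: s' then exists a : A, span s' (x - a *: g) else x = 0.

Lemma span_lin s a x y : span s x -> span s y -> span s (a *: x + y).
Proof.
elim: s x y => [|g s IH] x y /= => [-> ->|[b bx] [c cy]]; first by rewrite scaler0 addr0.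
exists (a * b + c); rewrite scalerDl -scalerA opprD addrACA -scalerN -scalerDr.
exact: IH.
Qed.

Lemma span0 s : span s 0.
Proof. by elim: s => //= g s IH; exists 0; rewrite scale0r subr0. Qed.

Lemma spanZ s a x : span s x -> span s (a *: x).
Proof. by move=> sx; rewrite -[_ *: _]addr0; apply: span_lin (span0 s). Qed.

Lemma spanD s x y : span s x -> span s y -> span s (x + y).
Proof. by move=> sx; rewrite -[x]scale1r; apply: span_lin. Qed.

Lemma span_mem s x : x \in s -> span s x.
Proof.
elim: s => //= g s IH; rewrite inE => /predU1P[->|/IH sx].
  by exists 1; rewrite scale1r subrr; apply: span0.
by exists 0; rewrite scale0r subr0.
Qed.

Lemma span_min s (L : M -> Prop) :
  L 0 -> (forall a x y, L x -> L y -> L (a *: x + y)) -> {in s, forall x, L x} ->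
  forall x, span s x -> L x.
Proof.
move=> L0 Llin; elim: s => [|g s IH] sL x /= => [->//|[a ax]].
rewrite -[x](subrK (a *: g)) addrC; apply: Llin; first by apply: sL; rewrite mem_head.
by apply: IH ax => y ys; apply: sL; rewrite inE ys orbT.
Qed.

Lemma span_sub s t : {subset s <= t} -> forall x, span s x -> span t x.
Proof.
move=> st; apply: span_min => [|a x y|x xs]; [exact: span0 | exact: span_lin |].
exact/span_mem/st.
Qed.

Lemma span_sum (I : finType) (g : I -> M) (c : I -> A) :
  span [seq g i | i <- enum I] (\sum_i c i *: g i).
Proof.
apply: big_ind => [|x y|i _]; [exact: span0 | exact: spanD | apply/spanZ/span_mem].
by apply: map_f; rewrite mem_enum.
Qed.

Definition fgmod := exists s, forall x, span s x.
End Span.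

(** * Resolutions by finitely generated free modules *)

Section FgResolution.
Variable A : nzRingType.
Hypothesis noeth : forall (M : lmodType A) (L : submodule M), fgmod M -> fgmod (submod L).

Record fgModule := FgModule { fgM : lmodType A; fgP : fgmod fgM }.
Implicit Type X : fgModule.

Definition fgens X : seq (fgM X) := sval (cid (fgP X)).
Definition fgfree X : lmodType A := {freeg 'I_(size (fgens X)) / A}.
Definition fgcov X : {linear fgfree X -> fgM X} := fglift (fun i : 'I_(size (fgens X)) =>
  (fgens X)`_i).

Lemma fgcov_surj X x : exists d, fgcov X d = x.
Proof.
move: x (svalP (cid (fgP X)) x); apply: span_min => [|a x y [d1 <-] [d2 <-]|x].
- by exists 0; exact: linear0.
- by exists (a *: d1 + d2); exact: linearP.
- move=> /(nthP 0)[k ks <-]; exists << Ordinal ks >>.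
  by rewrite /= liftU scale1r.
Qed.

Lemma fgfree_fg X : fgmod (fgfree X).
Proof.
exists [seq << i >> | i <- enum 'I_(size (fgens X))] => d.
elim/freeg_ind_dom0: d => [|c i d _ _ IH]; first exact: span0.
apply: spanD IH; have -> : << c *g i >> = c *: << i >> :> fgfree X.
  by apply/eqP/freeg_eqP => j; rewrite coeffZ !coeffU mul1r.
by apply/spanZ/span_mem/map_f; rewrite mem_enum.
Qed.

Definition fgker X : fgModule := FgModule (noeth (kernel (fgcov X)) (fgfree_fg X)).

Fact fgker_exact X (y : fgfree X) :
  fgcov X y = 0 <-> exists z : fgM (fgker X), smval z = y.
Proof.
split=> [/eqP y0|[z <-]]; last exact: (eqP (smvalP z)).
by exists (SubMod (y0 : y \in kernel (fgcov X))).
Qed.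

Fixpoint fgsyz X n : fgModule := if n is k.+1 then fgker (fgsyz X k) else X.

Definition fgres X : resolution A :=
  @Resolution A (fun n => fgM (fgsyz X n)) (fun n => fgfree (fgsyz X n))
    (fun n => fgcov (fgsyz X n))
    (fun n => smval (L := kernel (fgcov (fgsyz X n))))
    (fun n => @freeg_projective A _) (fun n => @fgcov_surj (fgsyz X n))
    (fun n => val_inj) (fun n => @fgker_exact (fgsyz X n)).

End FgResolution.

(** * Submodules of finitely generated modules over noetherian rings and algebras *)

Section Noetherian.
Variables (R : comPzRingType) (noethR : noetherian_ring R).

(** Induction on the generators: the coefficients of [g] occurring in L form an ideal I; lifts of
    generators of I, together with generators of the part of L inside the span of [s], generate
    L. *)
Lemma noetherian_span (V : lmodType R) (s : seq V) (L : V -> Prop) :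
  L 0 -> (forall a x y, L x -> L y -> L (a *: x + y)) -> (forall x, L x -> span s x) ->
  exists2 t, {in t, forall x, L x} & forall x, L x -> span t x.
Proof.
elim: s L => [|g s IH] L L0 Llin Ls; first by exists [::].
pose I : {pred R} := fun r => `[< exists2 x, L x & span s (x - r *: g) >].
have [||r a /asboolP[x Lx xs]|n [h [hI hgen]]] := noethR (I := I).
- by apply/asboolP; exists 0 => //; rewrite scale0r subr0; apply: span0.
- move=> a b /asboolP[x Lx xs] /asboolP[y Ly ys]; apply/asboolP.
  exists (x + y); first by rewrite -[x]scale1r; apply: Llin.
  by rewrite scalerDl opprD addrACA; apply: spanD.
- apply/asboolP; exists (r *: x); first by rewrite -[_ *: _]addr0; apply: Llin.
  by rewrite -scalerA -scalerBr; apply: spanZ.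
have /choice[x xP] i : exists x, L x /\ span s (x - h i *: g).
  by have /asboolP[x] := hI i; exists x.
have [||y [] //|t tL tgen] := IH (fun x => L x /\ span s x).
- by split=> //; apply: span0.
- by move=> a y z [Ly ys] [Lz zs]; split; [apply: Llin | apply: span_lin].
pose T := [seq x i | i <- enum 'I_n] ++ t.
have TL : {in T, forall y, L y}.
  move=> y; rewrite mem_cat => /orP[/mapP[i _ ->]|/tL[]//].
  exact: (xP i).1.
exists T => // y Ly.
have [r yr] := Ls y Ly.
have [c rc] : exists c : 'I_n -> R, r = \sum_(i < n) c i * h i.
  by apply: hgen; apply/asboolP; exists y.
pose z := \sum_i c i *: x i.
have Lsum (F : 'I_n -> V) : (forall i, L (F i)) -> L (\sum_i F i).
  move=> FL; apply: big_ind => // u v Lu Lv; rewrite -[u]scale1r; exact: Llin.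
have Lz : L z by apply: Lsum => i; rewrite -[_ *: _]addr0; apply: Llin => //; exact: (xP i).1.
rewrite -[y](subrK z); apply: spanD.
  have /tgen : L (y - z) /\ span s (y - z).
    split; first by rewrite addrC -scaleN1r; apply: Llin.
    (* Subtracting z cancels the coefficient of [g] in y and leaves an element of the span of
       [s]. *)
    have -> : y - z = (y - r *: g) + (-1) *: \sum_i c i *: (x i - h i *: g).
      rewrite scaleN1r; under eq_bigr => i _ do rewrite scalerBr scalerA.
      by rewrite sumrB -scaler_suml -rc opprB addrA subrK.
    apply: spanD => //; apply: spanZ; apply: big_ind => [|u v|i _].
    - exact: span0.
    - exact: spanD.
    - apply: spanZ; exact: (xP i).2.
  by apply: span_sub => u ut; rewrite mem_cat ut orbT.
by apply: (span_sub _ (span_sum x c)) => u ut; rewrite mem_cat ut.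
Qed.
End Noetherian.

Section NoetherianAlgebra.
Variables (R : comPzRingType) (Lam : algType R).
Hypotheses (noethR : noetherian_ring R) (noethLam : noetherian_algebra Lam).

Definition scal (r : R) : Lam^c := (r%:A : Lam).

Fact scal_zmod : zmod_morphism scal.
Proof. by move=> a b; exact: scalerBl. Qed.
Fact scal_monoid : monoid_morphism scal.
Proof.
split=> [|a b]; first exact: scale1r.
by rewrite -[RHS]/((b%:A : Lam) * a%:A) -scalerAl mul1r scalerA mulrC.
Qed.
HB.instance Definition _ := GRing.isZmodMorphism.Build R Lam^c scal scal_zmod.
HB.instance Definition _ := GRing.isMonoidMorphism.Build R Lam^c scal scal_monoid.

Lemma scal_central r (a : Lam^c) : scal r * a = a * scal r.
Proof.
by rewrite -[LHS]/((a : Lam) * r%:A) -[RHS]/((r%:A : Lam) * a) -scalerAl -scalerAr mul1r mulr1.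
Qed.

Lemma algebra_span : exists t : seq Lam^c, forall a : Lam^c, span (M :=
  resc scal (Lam^c)^o) t a.
Proof.
have [_ [n [g gP]]] := noethLam.
exists [seq (g i : Lam^c) | i <- enum 'I_n] => a; have [c ->] := gP a.
have -> : \sum_(i < n) c i *: g i = \sum_(i < n) c i *: (g i : resc scal (Lam^c)^o).
  apply: eq_bigr => i _; rewrite rescE -[RHS]/((g i : Lam) * (c i)%:A).
  by rewrite -scalerAr mulr1.
exact: (span_sum (M := resc scal (Lam^c)^o)).
Qed.

(** Over R, the products of algebra generators and module generators span M; a submodule is then
    finitely generated over R, hence over the algebra. *)
Lemma algebra_noetherian (M : lmodType Lam^c) (L : submodule M) :
  fgmod M -> fgmod (submod L).
Proof.
move=> [s sP]; have [t tP] := algebra_span; pose RM : lmodType R := resc scal M.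
pose T : seq RM := [seq (a : Lam^c) *: (m : M) | a <- t, m <- s].
have TP (x : M) : forall a : Lam^c, span T (a *: x : RM).
  move: x (sP x); apply: span_min => [a|a x y xT yT b|m ms a].
  - by rewrite scaler0; apply: span0.
  - by rewrite scalerDr scalerA; apply: spanD.
  move: a (tP a).
  apply: (@span_min _ _ _ (fun a : resc scal (Lam^c)^o => span T ((a : Lam^c) *: m : RM))).
  - by rewrite scale0r; apply: span0.
  - move=> r b c bT cT; rewrite scalerDl rescE; apply: spanD cT.
    by rewrite -scalerA; apply: (@spanZ _ RM).
  - by move=> b bt; apply: span_mem; apply/allpairsP; exists (b, m).
have [||x _|t' t'L t'P] := @noetherian_span R noethR RM T (fun x => x \in L).
- exact: rpred0.
- by move=> r; exact: (submod_predP L).2 (scal r).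
- by rewrite -[x]scale1r; exact: TP.
exists (pmap insub t' : seq (submod L)) => x; have /t'P := smvalP x.
suff : forall y : RM, span t' y -> exists2 z : submod L, smval z = y & span (M :=
  submod L) (pmap insub t') z.
  by move=> /[apply] -[z /val_inj ->].
apply: span_min => [|r y z [y' <- y's] [z' <- z's]|y yt].
- by exists 0 => //; apply: span0.
- by exists (scal r *: y' + z') => //; apply: span_lin.
- exists (SubMod (t'L _ yt)) => //; apply: span_mem.
  by rewrite mem_pmap_sub.
Qed.
End NoetherianAlgebra.

(** * Modules over a prime quotient of a noetherian algebra *)
Section PrimeDependence.
Variables (R : comPzRingType) (p : {pred R}).
Hypotheses (p0 : 0 \in p) (p1 : 1 \notin p) (pD : {in p &, forall a b, a + b \in p}).
Hypotheses (pM : forall r, {in p, forall a, r * a \in p}).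
Hypothesis pP : forall a b, a \notin p -> b \notin p -> a * b \notin p.

Let p_sum (I : finType) (F : I -> R) : (forall i, F i \in p) -> \sum_i F i \in p.
Proof. by move=> Fp; apply: (big_ind (fun x => x \in p)) => // a b; exact: pD. Qed.

(* Gaussian elimination over the domain R / p. *)
Lemma dependent_mod_prime m (v : 'I_m.+1 -> nat -> R) :
  exists c : 'I_m.+1 -> R, (exists i, c i \notin p) /\
    forall j, (j < m)%N -> \sum_i c i * v i j \in p.
Proof.
elim: m v => [|m IH] v; first by exists (fun=> 1); split=> //; exists ord0.
have [/forallP vp|/forallPn[k vk]] := boolP [forall i, v i m \in p].
  (* The last coordinate vanishes modulo p throughout, so one vector is discarded by giving it the
     coefficient 0. *)
  have [c [[i ci] cP]] := IH (fun i => v (fintype.lift ord_max i)).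
  exists (fun i => if unlift ord_max i is Some i' then c i' else 0); split.
    by exists (fintype.lift ord_max i); rewrite liftK.
  move=> j; rewrite ltnS leq_eqVlt => /predU1P[->|jm]; first by apply: p_sum => k; exact: pM.
  rewrite (bigD1_ord ord_max) //= unlift_none mul0r add0r.
  by under eq_bigr => k _ do rewrite liftK; exact: cP.
(* With [v k m] outside p as pivot, the last coordinate of the other vectors is cleared; the
   coefficient of the k-th vector collects what was subtracted. *)
have [c [[i ci] cP]] := IH (fun i j =>
  v k m * v (fintype.lift k i) j - v (fintype.lift k i) m * v k j).
exists (fun i => if unlift k i is Some i' then c i' * v k m
                 else - \sum_i c i * v (fintype.lift k i) m); split.
  by exists (fintype.lift k i); rewrite liftK; exact: pP.
move=> j; have -> : \sum_(i0 < m.+2) (if unlift k i0 is Some i' then c i' * v k m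
      else - \sum_i c i * v (fintype.lift k i) m) * v i0 j =
    \sum_i c i * (v k m * v (fintype.lift k i) j - v (fintype.lift k i) m * v k j).
  rewrite (bigD1_ord k) //= unlift_none addrC mulNr mulr_suml -sumrB.
  by apply: eq_bigr => l _; rewrite liftK mulrBr !mulrA.
rewrite ltnS leq_eqVlt => /predU1P[->|/cP //].
by apply: p_sum => l; rewrite [v k m * _]mulrC subrr mulr0.
Qed.
End PrimeDependence.

Lemma span_coord (A : pzRingType) (M : lmodType A) (s : seq M) x :
  span s x -> exists c : nat -> A, x = \sum_(j < size s) c j *: s`_j.
Proof.
elim: s x => [|g s IH] x /= => [->|[a /IH[c cP]]].
  by exists (fun=> 0); rewrite big_ord0.
exists (fun j => if j is k.+1 then c k else a).
by rewrite big_ord_recl /= -[x in LHS](subrK (a *: g)) cP addrC.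
Qed.

Section PrimeIdeal.
Variables (R : comPzRingType) (Lam : algType R) (P : primeSpec Lam).
Hypotheses (noethR : noetherian_ring R) (noethLam : noetherian_algebra Lam).
Local Notation A := (Lam^c).
Local Notation p := (contraction P).
Implicit Types (a b c u w x y : A) (r s : R).
Local Notation "x \inP" := (x \in prime_pred P) (at level 70).

Lemma prime0 : (0 : A) \inP. Proof. by case: (prime_predP P) => -[[]]. Qed.

Lemma primeB x y : x \inP -> y \inP -> (x - y) \inP.
Proof. by case: (prime_predP P) => -[[_ PB] _] _ _; exact: PB. Qed.

Lemma primeD x y : x \inP -> y \inP -> (x + y) \inP.
Proof.
by move=> Px Py; rewrite -[y]opprK; apply: primeB => //; rewrite -sub0r; apply: primeB =>
  //; exact: prime0.
Qed.

Lemma primeMl a x : x \inP -> (a * x) \inP.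
Proof. by case: (prime_predP P) => -[_ PM] _ _ Px; exact: (PM (a : Lam) x Px).2. Qed.

Lemma primeMr a x : x \inP -> (x * a) \inP.
Proof. by case: (prime_predP P) => -[_ PM] _ _ Px; exact: (PM (a : Lam) x Px).1. Qed.

Lemma prime1 : (1 : A) \notin prime_pred P.
Proof. by case: (prime_predP P). Qed.

Lemma prime_elt a b : (forall c, (a * c * b) \inP) -> a \inP \/ b \inP.
Proof.
move=> ab; case: (prime_predP P) => _ _ PP.
(* [J] consists of the y with a A y inside P, and [I] of the x with x A J inside P: two-sided ideals
   containing b and a respectively. *)
pose J : {pred Lam} := fun y => `[< forall c : A, (a * c * (y : A)) \inP >].
pose I : {pred Lam} := fun x => `[< forall y : A, (y : Lam) \in J ->
  forall c : A, ((x : A) * c * y) \inP >].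
have Jideal : two_sided_ideal J.
  split=> [|d y /asboolP yJ]; [split=> [|y z /asboolP yJ /asboolP zJ]|split];
    apply/asboolP => c.
  - by rewrite mulr0; exact: prime0.
  - by rewrite mulrBr; apply: primeB.
  - rewrite -[(d * y : Lam) : A]/((y : A) * (d : A)) mulrA; exact/primeMr.
  - rewrite -[(y * d : Lam) : A]/((d : A) * (y : A)) mulrA -[a * c * _]mulrA; exact: yJ.
have Iideal : two_sided_ideal I.
  split=> [|d x /asboolP xI]; [split=> [|x z /asboolP xI /asboolP zI]|split];
    apply/asboolP => y yJ c.
  - by rewrite !mul0r; exact: prime0.
  - by rewrite !mulrBl; apply: primeB; [apply: xI | apply: zI].
  - rewrite -[(d * x : Lam) : A]/((x : A) * (d : A)) -[(x : A) * _ * c]mulrA; exact: xI.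
  - rewrite -[(x * d : Lam) : A]/((d : A) * (x : A)) -!mulrA; apply: primeMl; rewrite mulrA;
    exact: xI.
(* [J] comes first because the product of [Lam] is the reverse of that of [A]. *)
have [|JP|IP] := PP J I Jideal Iideal.
- move=> y x yJ /asboolP/(_ y yJ 1); rewrite mulr1; exact.
- by right; apply: JP; apply/asboolP.
- by left; apply: IP; apply/asboolP => y /asboolP; exact.
Qed.

(** The image of r is central, so every r c a lies in P and primeness applies: R \ p acts regularly
    on Lam / P. *)
Lemma scal_prime r a : r \notin p -> (scal Lam r * a) \inP -> a \inP.
Proof.
move=> rp ra; have [c||//] := @prime_elt (scal Lam r) a; last by move=> h; case/negP: rp.
by rewrite scal_central -mulrA; apply: primeMl.
Qed.

Lemma contraction0 : 0 \in p.
Proof. by rewrite unfold_in scale0r; exact: prime0. Qed.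
Lemma contraction1 : 1 \notin p.
Proof. by rewrite unfold_in scale1r; exact: prime1. Qed.
Lemma contractionD : {in p &, forall r s, r + s \in p}.
Proof. by move=> r s rp sp; rewrite unfold_in scalerDl; exact: primeD. Qed.
Lemma contractionMl r : {in p, forall s, r * s \in p}.
Proof.
move=> s sp; have : scal Lam r * scal Lam s \inP by exact: primeMl.
by rewrite -rmorphM.
Qed.
Lemma contractionM r s : r \notin p -> s \notin p -> r * s \notin p.
Proof.
move=> rp sp; apply: contraNN sp; rewrite /contraction => rs.
have : scal Lam r * scal Lam s \inP by rewrite -rmorphM.
exact: scal_prime.
Qed.

(** * Left ideals of [A], that is right ideals of [Lam], and their rank over R / p *)

Definition left_ideal (U : A -> Prop) : Prop :=
  U 0 /\ forall a x y, U x -> U y -> U (a * x + y).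

Definition nonzero_mod (U : A -> Prop) : Prop := exists u, U u /\ u \notin prime_pred P.

(** Linear independence over the domain R / p of the classes in Lam / P. *)
Definition independent k (x : 'I_k -> A) : Prop :=
  forall c : 'I_k -> R, (\sum_i scal Lam (c i) * x i) \inP -> forall i, c i \in p.

Definition rank_ge (U : A -> Prop) k : Prop :=
  exists x : 'I_k -> A, (forall i, U (x i)) /\ independent x.

Lemma left_idealZ U a x : left_ideal U -> U x -> U (a * x).
Proof. by move=> [U0 UL] Ux; rewrite -[_ * _]addr0; apply: UL. Qed.

Lemma left_idealB U x y : left_ideal U -> U x -> U y -> U (x - y).
Proof. by move=> [U0 UL] Ux Uy; rewrite addrC -mulN1r; apply: UL. Qed.

Lemma prime_sum (I : finType) (F : I -> A) : (forall i, F i \inP) -> (\sum_i F i) \inP.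
Proof.
move=> FP; apply: (big_ind (fun x : A => x \inP)) => // [|x y]; [exact: prime0 |
  exact: primeD].
Qed.

(** [Lam] is spanned over R by finitely many elements, and a longer family has dependent coordinates
    modulo p. *)
Lemma rank_bounded : exists m, forall U, ~ rank_ge U m.+1.
Proof.
have [t tP] := algebra_span noethLam; exists (size t) => U [x [_ xind]].
have /choice[v vP] i := span_coord (tP (x i)).
have [c [[i ci] cP]] := dependent_mod_prime contraction0 contraction1
  contractionD contractionMl contractionM v.
case/negP: ci; apply: (xind c).
have {}vP k : x k = \sum_(j < size t) scal Lam (v k j) * t`_j := vP k.
have -> : \sum_k scal Lam (c k) * x k =
    \sum_(j < size t) scal Lam (\sum_k c k * v k j) * t`_j.
  under eq_bigr => k _ do rewrite vP mulr_sumr.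
  rewrite exchange_big; apply: eq_bigr => j _; rewrite rmorph_sum mulr_suml.
  by apply: eq_bigr => k _; rewrite rmorphM mulrA.
by apply: prime_sum => j; apply: primeMr; exact: cP.
Qed.

(* A left ideal of minimal rank will do. *)
Lemma simple_left_ideal : exists U, [/\ left_ideal U, nonzero_mod U &
  forall U', left_ideal U' -> (forall x, U' x -> U x) -> nonzero_mod U' ->
    forall u, U u -> exists s u', [/\ s \notin p, U' u' & (scal Lam s * u - u') \inP]].
Proof.
pose Q (k : nat) := `[< exists U, [/\ left_ideal U, nonzero_mod U & ~ rank_ge U k.+1] >].
have Qex : exists k, Q k.
  have [m mP] := rank_bounded; exists m; apply/asboolP; exists (fun=> True).
  by split=> //; exists 1; split=> //; exact: prime1.
case: (ex_minnP Qex) => k /asboolP[U [Uid Unz Urk]] kmin.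
exists U; split=> // U' U'id U'U U'nz u Uu.
(* A smaller rank of [U'] would contradict the minimality of [k]; for [k = 0] the empty family
   serves. *)
have [x [xU' xind]] : rank_ge U' k.
  case: k kmin {Urk} => [|k] kmin; first by exists (fun=> 0); split=> [[]|c _ []].
  apply: contrapT => U'rk; have /kmin : Q k by apply/asboolP; exists U'.
  by rewrite ltnn.
pose y (i : 'I_k.+1) := if unlift ord_max i is Some j then x j else u.
have yU i : U (y i) by rewrite /y; case: unlift => [j|] //; apply: U'U.
have : ~ independent y by move=> yind; apply: Urk; exists y.
move=> /existsNP[c] /not_implyP[cy /existsNP[i /negP ci]].
move: cy; rewrite (bigD1_ord ord_max) //= /y unlift_none.
under eq_bigr => j _ do rewrite liftK.
set S := \sum_(j < k) _ => uS.
have SU' : U' S.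
  rewrite /S; apply: big_ind => [|a b|j _]; first by case: U'id.
    by move=> ? ?; rewrite -[a]mul1r; apply: U'id.2.
  exact: left_idealZ.
(* A coefficient of u outside p is the required denominator. Otherwise the relation reduces to one
   among the independent x, which forces all coefficients into p. *)
have [cp|cp] := boolP (c ord_max \in p); last first.
  exists (c ord_max), (- S); split=> //; last by rewrite opprK.
  by rewrite -sub0r; apply: left_idealB => //; case: U'id.
case/negP: ci; have : S \inP.
  have -> : S = (scal Lam (c ord_max) * u + S) - scal Lam (c ord_max) * u by rewrite addrC addKr.
  by apply: primeB => //; apply: primeMr.
by move=> /xind cj; case: (unliftP ord_max i) => [j|] ->.
Qed.

(** * Essential submodules of a module over Lam / P *)

Section TorsionQuotient.
Variables (M : lmodType A) (H : submodule M).
Hypothesis PM : forall a (x : M), a \inP -> a *: x = 0.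
Hypothesis H_essential : forall L : submodule M, nonzero L ->
  exists2 x, x \in L & x \in H /\ x != 0.

Definition torsion_mod (x : M) : Prop := exists2 s, s \notin p & scal Lam s *: x \in H.

Lemma torsion_modD (x y : M) : torsion_mod x -> torsion_mod y -> torsion_mod (x + y).
Proof.
move=> [s sp sx] [t tp ty]; exists (s * t); first exact: contractionM.
rewrite rmorphM scalerDr rpredD //; last by rewrite -scalerA rpredZ.
by rewrite scal_central -scalerA rpredZ.
Qed.

Lemma torsion_modV s (x : M) : s \notin p -> torsion_mod (scal Lam s *: x) -> torsion_mod x.
Proof.
move=> sp [t tp tx]; exists (t * s); first exact: contractionM.
by rewrite rmorphM -scalerA.
Qed.

Lemma torsion_mod_congr a b (y : M) : (a - b) \inP -> a *: y = b *: y.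
Proof. by move=> ab; apply/eqP; rewrite -subr_eq0 -scalerBl PM. Qed.

Variable U : A -> Prop.
Hypothesis U_ideal : left_ideal U.
Hypothesis U_simple : forall U', left_ideal U' -> (forall x, U' x -> U x) -> nonzero_mod U' ->
    forall u, U u -> exists s u', [/\ s \notin p, U' u' & (scal Lam s * u - u') \inP].

(** Right multiplication by u embeds W modulo P into U, so W inherits simplicity up to torsion. If W
    y is nonzero it meets the essential H, and the w in W with w y in H then contain, modulo P, a
    multiple of every element of W. *)
Lemma torsion_embedded W u :
  left_ideal W -> U u -> (forall w, W w -> (w * u) \inP -> w \inP) ->
  forall w (y : M), W w -> torsion_mod (w *: y).
Proof.
move=> Wid Uu Wu w y Ww.
have [->|wy0] := eqVneq (w *: y) 0; first by exists 1; [exact: contraction1 |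
  rewrite scaler0 rpred0].
pose L : {pred M} := fun x : M => `[< exists2 w, W w & x = w *: y >].
have L_closed : submod_closed L.
  split=> [|a x z /asboolP[w1 Ww1 ->] /asboolP[w2 Ww2 ->]]; apply/asboolP.
    by exists 0; rewrite ?scale0r //; case: Wid.
  by exists (a * w1 + w2); rewrite ?scalerDl ?scalerA //; apply: Wid.2.
have [|x /asboolP[w0 Ww0 ->] [w0H w0y]] := H_essential (L := Submodule L_closed).
  by exists (w *: y) => //; apply/asboolP; exists w.
have [||||s [u' [sp [w' [Ww' w'H] ->]]]] := @U_simple (fun x =>
  exists2 w, W w /\ w *: y \in H & x = w * u) _ _ _ (w * u).
- split=> [|a x1 z [w1 [Ww1 w1H] ->] [w2 [Ww2 w2H] ->]].
    by exists 0; rewrite ?mul0r // scale0r rpred0; split=> //; case: Wid.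
  exists (a * w1 + w2); last by rewrite mulrDl mulrA.
  split; first exact: Wid.2.
  by rewrite scalerDl -scalerA rpredD // rpredZ.
- by move=> z [w1 _ ->]; apply: left_idealZ.
- exists (w0 * u); split; first by exists w0.
  by apply: contraNN w0y => /(Wu _ Ww0) ?; rewrite PM.
- exact: left_idealZ.
rewrite mulrA -mulrBl => /Wu ww'; exists s => //.
rewrite scalerA (@torsion_mod_congr _ w') //; apply: ww'.
by apply: left_idealB => //; apply: left_idealZ.
Qed.

(** The right multiplications by the members of [us] embed W modulo P into a power of U; the
    induction removes one factor at a time. *)
Lemma torsion_filtered (us : seq A) W : left_ideal W -> {in us, forall u, U u} ->
  (forall w, W w -> (forall u, u \in us -> (w * u) \inP) -> w \inP) ->
  forall w (y : M), W w -> torsion_mod (w *: y).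
Proof.
elim: us W => [|u us IH] W Wid usU Wus w y Ww.
  exists 1; first exact: contraction1.
  by rewrite (PM _ (Wus w Ww _)) ?scaler0 ?rpred0.
have Uu : U u by apply: usU; rewrite mem_head.
have us'U : {in us, forall u, U u} by move=> v vs; apply: usU; rewrite inE vs orbT.
pose W0 x := W x /\ forall u, u \in us -> (x * u) \inP.
have W0id : left_ideal W0.
  split=> [|a x z [Wx xus] [Wz zus]]; split.
  - by case: Wid.
  - by move=> v _; rewrite mul0r; exact: prime0.
  - exact: Wid.2.
  - by move=> v vs; rewrite mulrDl -mulrA; apply: primeD; [apply/primeMl/xus | apply: zus].
have W0u x : W0 x -> (x * u) \inP -> x \inP.
  by move=> [Wx xus] xu; apply: Wus => // v /predU1P[->|/xus].
have W0tors := torsion_embedded W0id Uu W0u.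
have [W0nz|W0z] := pselect (nonzero_mod W0); last first.
  apply: (IH W) => // x Wx xus; apply: contrapT => /negP xP.
  by apply: W0z; exists x.
pose W1 x := W x /\ (x * u) \inP.
have W1id : left_ideal W1.
  split=> [|a x z [Wx xu] [Wz zu]]; split.
  - by case: Wid.
  - by rewrite mul0r; exact: prime0.
  - exact: Wid.2.
  - by rewrite mulrDl -mulrA; apply: primeD => //; apply: primeMl.
have W1tors : forall w (z : M), W1 w -> torsion_mod (w *: z).
  apply: IH => // x [Wx xu] xus; apply: Wus => // v /predU1P[->//|]; exact: xus.
(* W0 u is nonzero modulo P, so it contains some s w u modulo P. Thus s w is the sum of an element
   of W0, embedded by u, and one of W1, covered by induction. *)
have [||||s [u' [sp [w0 W0w0 ->]]]] := @U_simple (fun x =>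
  exists2 w, W0 w & x = w * u) _ _ _ (w * u).
- split=> [|a x z [w1 Ww1 ->] [w2 Ww2 ->]].
    by exists 0; rewrite ?mul0r //; case: W0id.
  by exists (a * w1 + w2); rewrite ?mulrDl ?mulrA //; apply: W0id.2.
- by move=> x [w1 _ ->]; apply: left_idealZ.
- have [x [W0x xP]] := W0nz; exists (x * u); split; first by exists x.
  by apply: contraNN xP; exact: W0u.
- exact: left_idealZ.
rewrite mulrA -mulrBl => sw; apply: (torsion_modV sp).
rewrite scalerA -[_ * w](subrK w0) scalerDl; apply: torsion_modD; last exact: W0tors.
by apply: W1tors; split=> //; apply: left_idealB => //; [apply: left_idealZ | case: W0w0].
Qed.
End TorsionQuotient.

(** Plays the part of Goldie theory: P is prime and U is not inside P, so right multiplication by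
    generators of U over R embeds A / P into a power of U. The filtered statement is applied to W =
    A and w = 1. *)
Lemma torsion_quotient (M : lmodType A) (H : submodule M) :
  (forall a (x : M), a \inP -> a *: x = 0) ->
  (forall L : submodule M, nonzero L -> exists2 x, x \in L & x \in H /\ x != 0) ->
  forall x : M, exists2 s, s \notin p & scal Lam s *: x \in H.
Proof.
move=> PM Hess x; have [U [Uid Unz Usimple]] := simple_left_ideal.
have [t tP] := algebra_span noethLam.
have [||y _|us usU usP] := @noetherian_span R noethR (resc (scal Lam) (Lam^c)^o) t U.
- by case: Uid.
- by move=> r; apply: Uid.2.
- exact: tP.
rewrite -[x]scale1r.
apply: (@torsion_filtered M H PM Hess U Uid Usimple us (fun=> True)) => // w _ wus.
have wU v : U v -> (w * v) \inP.
  move=> /usP; move: v; apply: (@span_min _ _ us (fun v : A => (w * v) \inP)).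
  - by rewrite mulr0; exact: prime0.
  - move=> r v1 v2 v1P v2P; rewrite rescE mulrDr; apply: primeD => //.
    by rewrite -[scal Lam r *: v1]/(scal Lam r * v1) mulrA -scal_central -mulrA;
      apply: primeMl.
  - by move=> v; exact: wus.
have [u [Uu uP]] := Unz.
have [c|//|uP'] := @prime_elt w u; last by case/negP: uP.
by rewrite -mulrA; apply: wU; apply: left_idealZ.
Qed.
End PrimeIdeal.

(** * The modules I(P) and S(P) *)
Section Uniform.
Variable A : nzRingType.
Implicit Types (H M N : lmodType A).

Definition uniform M : Prop := forall L N : submodule M, nonzero L -> nonzero N ->
  exists2 x, x \in L & x \in N /\ x != 0.

Lemma scale_pi M (L : submodule M) a x :
  a *: (\pi_({ideal_quot L}) x : quotmod L) = \pi_({ideal_quot L}) (a *: x).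
Proof. exact: pi_scale. Qed.

Fact add_submod_closed M (L N : submodule M) :
  submod_closed [pred x | `[< exists y z, [/\ y \in L, z \in N & x = y + z] >]].
Proof.
split=> [|a x x' /asboolP[y [z [yL zN ->]]] /asboolP[y' [z' [y'L z'N ->]]]]; apply/asboolP.
  by exists 0, 0; rewrite !rpred0 addr0.
exists (a *: y + y'), (a *: z + z').
by split; [rewrite rpredD // rpredZ | rewrite rpredD // rpredZ | rewrite scalerDr addrACA].
Qed.
Definition add_submod M (L N : submodule M) := Submodule (add_submod_closed L N).

(** If L and N met in 0, then (L + N) / N would be isomorphic to L, which monoformness forbids. *)
Lemma monoform_uniform H : monoform H -> uniform H.
Proof.
move=> [_ Hmono] L N Lnz Nnz; apply: contrapT => LN.
have LN0 x : x \in L -> x \in N -> x = 0.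
  by move=> xL xN; apply/eqP; apply: contrapT => /negP x0; apply: LN; exists x.
have sL x : x \in L -> x \in add_submod L N.
  by move=> xL; apply/asboolP; exists x, 0; rewrite rpred0 addr0.
have sN x : x \in N -> x \in add_submod L N.
  by move=> xN; apply/asboolP; exists 0, x; rewrite rpred0 add0r.
apply: (Hmono N (add_submod L N) L) => //.
  by move=> sub; have [x xL x0] := Lnz; apply: LN; exists x => //; split=> //; apply/sub/sL.
set K := preim_submod _ _.
pose f (x : submod L) : quotmod K := \pi_({ideal_quot K}) (SubMod (sL _ (smvalP x))).
have fl : linear f.
  move=> a x y; rewrite /f scale_pi -[RHS]raddfD; congr (\pi _).
  by apply: val_inj => /=; rewrite ?linearP.
have [g gE] := linear_mk fl.
have [x y||h [gK hK]] := @linear_inverse _ _ _ g; last by exists h, g.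
  rewrite !gE => /eqP; rewrite -Quotient.idealrBE => xy.
  have /eqP := LN0 (smval x - smval y) (rpredB (smvalP x) (smvalP y)) xy.
  by rewrite subr_eq0 => /eqP/val_inj.
move=> q; have /asboolP[y [z [yL zN yz]]] := smvalP (repr q).
exists (SubMod yL); rewrite gE -[q]reprK; apply/eqP; rewrite -Quotient.idealrBE.
by rewrite unfold_in /= yz opprD addrA subrr sub0r rpredN.
Qed.

Lemma envelope_uniform H M : uniform H -> injective_envelope H M -> uniform M.
Proof.
move=> Hu [_ [j ji jess]] L N Lnz Nnz.
have pre (K : submodule M) : nonzero K -> nonzero (preim_submod j K).
  by move=> /jess[x x0 xK]; exists x.
have [x xL [xN x0]] := Hu _ _ (pre _ Lnz) (pre _ Nnz).
by exists (j x) => //; split=> //; rewrite -(raddf0 j) (inj_eq ji).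
Qed.

Fact im_submod_closed M N (f : {linear M -> N}) (L : submodule M) :
  submod_closed [pred y | `[< exists2 x, x \in L & y = f x >]].
Proof.
split=> [|a y y' /asboolP[x xL ->] /asboolP[x' x'L ->]]; apply/asboolP.
  by exists 0; rewrite ?rpred0 ?raddf0.
by exists (a *: x + x'); rewrite ?linearP // rpredD // rpredZ.
Qed.
Definition im_submod M N (f : {linear M -> N}) (L : submodule M) :=
  Submodule (im_submod_closed f L).

Lemma uniform_embedded M N (f : {linear M -> N}) : injective f -> uniform N -> uniform M.
Proof.
move=> fi Nu L K [x xL x0] [y yK y0].
have im (V : submodule M) z : z \in V -> z != 0 -> nonzero (im_submod f V).
  move=> zV z0; exists (f z); first by apply/asboolP; exists z.
  by rewrite -(raddf0 f) (inj_eq fi).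
have [w /asboolP[z zL ->] [/asboolP[z' z'K /fi zz'] fz0]] :=
  Nu _ _ (im L x xL x0) (im K y yK y0).
exists z => //; split; first by rewrite zz'.
by apply: contraNneq fz0 => ->; rewrite raddf0.
Qed.

Fact cyclic_submod_closed M (x : M) :
  submod_closed [pred y | `[< exists a : A, y = a *: x >]].
Proof.
split=> [|a y y' /asboolP[b ->] /asboolP[c ->]]; apply/asboolP.
  by exists 0; rewrite scale0r.
by exists (a * b + c); rewrite scalerDl scalerA.
Qed.
Definition cyclic_submod M (x : M) := Submodule (cyclic_submod_closed x).

Lemma mem_cyclic M (x : M) : x \in cyclic_submod x.
Proof. by apply/asboolP; exists 1; rewrite scale1r. Qed.

Fact full_submod_closed M : @submod_closed A M predT.
Proof. by []. Qed.
Definition full_submod M : submodule M := Submodule (full_submod_closed M).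

Lemma atom_equiv_refl M : (exists x : M, x != 0) -> atom_equiv M M.
Proof.
move=> [x x0]; have nz : nonzero (full_submod M) by exists x.
exists (NzSub nz), (NzSub nz), idfun; exact: (Bijective (g := idfun)).
Qed.

End Uniform.

Section InjectiveOfPrime.
Variables (R : comPzRingType) (Lam : algType R) (P : primeSpec Lam).
Variables (IP : lmodType Lam^c).
Hypothesis hIP : is_I_of_prime P IP.
Hypotheses (noethR : noetherian_ring R) (noethLam : noetherian_algebra Lam).

Lemma I_uniform : uniform IP.
Proof. by have [H [/monoform_uniform Hu _ /(envelope_uniform Hu)]] := hIP. Qed.

(* Thus [y] spans a copy of the submodule of Lam / P generated by the class of [b]. *)
Lemma I_annihilator (L : submodule IP) : nonzero L ->
  exists y (b : Lam^c), [/\ y \in L, b \notin prime_pred P &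
    forall a : Lam^c, a *: y = 0 <-> a * b \in prime_pred P].
Proof.
have [H [Hmono HP [_ [j ji jess]]]] := hIP.
have /HP[U [Umono HU]] : atom H = atom H by [].
have [L1 [N1 [f [f' fK f'K]]]] : atom_equiv H (submod U).
  suff : atom H (submod U) by case.
  by rewrite HU; split=> //; apply: atom_equiv_refl; case: Umono.
move=> /jess[x x0 xL].
(* A nonzero multiple of x lies in [L1], which [f] carries into Lam / P. A representative of its
   image is the required b. *)
have [|z /asboolP[a ->] [zL1 z0]] := monoform_uniform Hmono (L := cyclic_submod x) _ (nzsP L1).
  by exists x => //; exact: mem_cyclic.
pose q : quotmod (prime_submod P) := smval (smval (f (SubMod zL1))).
have qE b : b *: q = smval (smval (f (b *: SubMod zL1))) by rewrite !linearZ_LR.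
have q0 b : b *: q = 0 <-> b *: (j (a *: x)) = 0.
  rewrite qE -linearZ_LR; split=> [q0|].
    have /(can_inj fK) e : f (b *: SubMod zL1) = f 0 by rewrite raddf0; do 2!apply: val_inj.
    by rewrite -[b *: (a *: x)]/(smval (b *: SubMod zL1)) e raddf0.
  rewrite -(raddf0 j) => /ji e.
  have -> : b *: SubMod zL1 = 0 by apply: val_inj.
  by rewrite raddf0.
exists (j (a *: x)), (repr q); split.
- by rewrite linearZ_LR rpredZ.
- apply: contraNN z0 => qP; rewrite -(inj_eq ji) raddf0 -[j _]scale1r; apply/eqP/q0.
  by rewrite scale1r -[q]reprK; apply/pi_ideal_eq0.
- move=> b; rewrite -q0 -[q in b *: q]reprK scale_pi.
  exact: pi_ideal_eq0.
Qed.

(** Every nonzero submodule of I(P) contains a copy of a nonzero submodule of Lam / P, on which s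
    acts regularly. *)
Lemma I_torsion_free s (x : IP) : s \notin contraction P -> scal Lam s *: x = 0 -> x = 0.
Proof.
move=> sp sx; apply/eqP; apply: contrapT => /negP x0.
have [|y [b [/asboolP[a ->] bP ya]]] := I_annihilator (L := cyclic_submod x).
  by exists x => //; exact: mem_cyclic.
case/negP: bP; apply: (scal_prime sp); apply/ya.
by rewrite scalerA scal_central -scalerA sx scaler0.
Qed.

Local Notation S := (S_mod P IP).

Lemma S_killed (a : Lam^c) (x : S) : a \in prime_pred P -> a *: x = 0.
Proof. by move=> aP; apply: val_inj; have /asboolP/(_ a aP) := smvalP x. Qed.

Lemma S_torsion_free s (x : S) : s \notin contraction P -> scal Lam s *: x = 0 -> x = 0.
Proof. by move=> sp /(congr1 (fun y => smval y))/= /(I_torsion_free sp) ?; apply: val_inj. Qed.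

Lemma S_uniform : uniform S.
Proof. exact: (uniform_embedded (f := smval (L := S_submod P IP)) val_inj I_uniform). Qed.

Lemma S_torsion_quotient (H : submodule S) : nonzero H ->
  forall x : S, exists2 s, s \notin contraction P & scal Lam s *: x \in H.
Proof.
move=> Hnz; apply: (torsion_quotient noethR noethLam) => [a x|L Lnz].
  exact: S_killed.
exact: S_uniform.
Qed.

(** The element y whose annihilator is that of the class of b is killed by P, because P b lies in
    P. *)
Lemma S_nonzero : exists x : S, x != 0.
Proof.
have [H [[[x x0] _] _ [_ [j ji jess]]]] := hIP.
have [|y [b [_ bP ya]]] := I_annihilator (L := full_submod IP).
  by exists (j x) => //; rewrite -(raddf0 j) (inj_eq ji).
have yS : y \in S_submod P IP by apply/asboolP => a aP; apply/ya; apply: primeMr.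
exists (SubMod yS); apply: contraNneq bP => /(congr1 (fun y => smval y)) /= y0.
by rewrite -[b]mul1r; apply/ya; rewrite y0 scaler0.
Qed.

End InjectiveOfPrime.

(** * Extension groups of atoms *)
Section DirectedColimit.
Variables (I : choiceType) (le : I -> I -> Prop) (X : I -> zmodType).
Variable t : forall i j, le i j -> {additive X i -> X j}.
Hypothesis le_trans : forall i j k, le i j -> le j k -> le i k.
Hypothesis le_directed : forall i j, exists k, le i k /\ le j k.
Hypothesis t_comp : forall i j k (h : le i j) (h' : le j k) (h'' : le i k) x,
  t h' (t h x) = t h'' x.

(** Directedness moves the terms of a formal sum to one stage; [i0] supplies a stage for the empty
    sum. *)
Lemma colim_in_surj (i0 : I) (e : colim t) : exists i (x : X i), e = colim_in t x.
Proof.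
rewrite -[e](@reprK _ {ideal_quot (colim_pred t)}).
elim/freeg_ind_dom0: (repr _) => [|c [i x] z _ _ [j [y zy]]].
  by exists i0, 0; rewrite !raddf0.
have [k [ik jk]] := le_directed i j.
have xE : \pi_({ideal_quot (colim_pred t)}) << c *g existT X i x >> =
    colim_in t (t ik (x *~ c)).
  have -> : << c *g existT X i x >> = formal x *~ c.
    by rewrite freeg_mulz; congr << _ *g _ >>; rewrite intz.
  by rewrite colim_inP [LHS]raddfMz [RHS]raddfMz.
exists k, (t ik (x *~ c) + t jk y); rewrite [LHS]raddfD [RHS]raddfD.
by congr (_ + _); [exact: xE | rewrite [RHS]colim_inP].
Qed.

(** The value of a generator at stage k. The default 0 is harmless, since only sufficiently late
    stages are considered. *)
Let stage k (p : {i : I & X i}) : X k :=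
  if pselect (le (tag p) k) is left h then t h (tagged p) else 0.

Let stage_lin k : {linear {freeg {i : I & X i} / int} -> zmodule (X k)} :=
  fglift (fun p => stage k p : zmodule (X k)).

Let stage_formal i k (h : le i k) (x : X i) : stage_lin k (formal x) = t h x.
Proof.
rewrite /= liftU scale1r /stage /=; case: pselect => [h'|//].
by have [l [kl _]] := le_directed k k; rewrite (Prop_irrelevance h h').
Qed.

(** The formal sums that vanish at all late stages form a subgroup containing the defining
    relations, hence everything that is zero in the colimit. *)
Lemma colim_in_eq0 i (x : X i) : colim_in t x = 0 -> exists j (h : le i j), t h x = 0.
Proof.
move=> /pi_ideal_eq0/asboolP.
pose S : {pred {freeg {i : I & X i} / int}} :=
  fun z => `[< exists k0, forall k, le k0 k -> stage_lin k z = 0 >].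
move=> /(_ S) xS; have /asboolP[k0 k0P] : formal x \in S.
  apply: xS => [|r].
    split=> [|y z /asboolP[k yk] /asboolP[l zl]]; apply/asboolP.
      by exists i => k _; exact: raddf0.
    have [m [km lm]] := le_directed k l; exists m => n mn.
    by rewrite raddfB /= (yk n (le_trans km mn)) (zl n (le_trans lm mn)) subr0.
  case=> [j y z|j l h y]; apply/asboolP.
    exists j => k jk; rewrite raddfB raddfD /= !(stage_formal jk) raddfD.
    exact: (subrr (t jk y + t jk z)).
  exists l => k lk; rewrite raddfB /= (stage_formal lk) (stage_formal (le_trans h lk)).
  by rewrite (t_comp _ _ (le_trans h lk)); exact: (subrr (t (le_trans h lk) y)).
have [k [k0k ik]] := le_directed k0 i.
by exists k, ik; rewrite -(stage_formal ik) k0P.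
Qed.
End DirectedColimit.

(** Projection to the top term is inverted by taking preimages in every term; injectivity makes
    these compatible. *)
Lemma lim_top (I : Type) (le : I -> I -> Prop) (X : I -> zmodType)
    (t : forall i j, le i j -> {additive X i -> X j}) (top : I) (le_top : forall i, le i top) :
  (forall i j k (h : le i j) (h' : le j k) (h'' : le i k) x, t _ _ h' (t _ _ h x) = t _ _ h'' x) ->
  (forall i, bijective (t _ _ (le_top i))) -> group_isomorphic (lim t) (X top).
Proof.
move=> t_comp t_bij.
have [|f fE] := @additive_mk (lim t) (X top) (fun z => limf z top); first by [].
have limE (z : lim t) i j (h : le i j) : t _ _ h (limf z i) = limf z j.
  by have /asboolP := limP z; exact.
exists f; apply: bijective_of => [z|y].
  rewrite fE => z0; apply: val_inj; apply/functional_extensionality_dep => i /=.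
  by apply: (bij_inj (t_bij i)); rewrite limE z0 raddf0.
have t_surj i : exists x, t _ _ (le_top i) x = y.
  by have [g _ gK] := t_bij i; exists (g y).
pose g : depprod X := fun i => sval (cid (t_surj i)).
have gE i : t _ _ (le_top i) (g i) = y := svalP (cid (t_surj i)).
have g_lim : g \in lim_pred t.
  apply/asboolP => i j h; apply: (bij_inj (t_bij j)).
  by rewrite (t_comp _ _ _ _ _ (le_top i)) !gE.
exists (Lim g_lim); rewrite fE /= -(gE top); apply: (bij_inj (t_bij top)).
by rewrite (t_comp _ _ _ _ _ (le_top top)).
Qed.

(** * Ext out of an atom with uniform representative *)

Section ExtOfAtom.
Variables (A : nzRingType) (n : nat) (H : lmodType A).
Hypothesis Huni : uniform H.
Implicit Types (L K : nzsub H) (N : lmodType A).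

Lemma nzsub_directed L L' : exists K, {subset K <= L} /\ {subset K <= L'}.
Proof.
have [x xL [xL' x0]] := Huni (nzsP L) (nzsP L').
have nz : nonzero (cyclic_submod x) by exists x => //; exact: mem_cyclic.
by exists (NzSub nz); split=> y /asboolP[a ->]; rewrite rpredZ.
Qed.

Lemma fgmod_cyclic (M : lmodType A) (x : M) : fgmod (submod (cyclic_submod x)).
Proof.
exists [:: SubMod (mem_cyclic x)] => y; have /asboolP[a ya] := smvalP y.
by exists a; apply: val_inj; rewrite /= ya subrr.
Qed.

Lemma nzsub_fg L : exists K, {subset K <= L} /\ fgmod (submod K).
Proof.
have [x xL x0] := nzsP L.
have nz : nonzero (cyclic_submod x) by exists x => //; exact: mem_cyclic.
exists (NzSub nz); split; last exact: fgmod_cyclic.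
by move=> y /asboolP[a ->]; rewrite rpredZ.
Qed.

Lemma ext_restr_comp N L L' L'' (h : sup_nzsub L L') (h' : sup_nzsub L' L'')
    (h'' : sup_nzsub L L'') x :
  ext_restr n N h' (ext_restr n N h x) = ext_restr n N h'' x.
Proof. by apply: ext_pull_comp => y; apply: val_inj. Qed.

Lemma sup_nzsub_trans L L' L'' : sup_nzsub L L' -> sup_nzsub L' L'' -> sup_nzsub L L''.
Proof. by move=> h h' x /h'/h. Qed.

(** By uniformity the index set is directed, and the cyclic submodules inside [L0] are cofinal in
    it. *)
Lemma ext_atom_surj N L0 (e : ExtAtomMod n H N) :
  exists L (x : Ext n (submod L) N),
    [/\ {subset L <= L0}, fgmod (submod L) & e = colim_in (ext_restr n N) x].
Proof.
have [L [x ->]] := colim_in_surj nzsub_directed L0 e.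
have [K [KL KL0]] := nzsub_directed L L0.
have [K' [K'K K'fg]] := nzsub_fg K.
have h : sup_nzsub L K' by move=> y /K'K/KL.
exists K', (ext_restr n N h x); split=> //; first by move=> y /K'K/KL0.
by rewrite colim_inP.
Qed.

Lemma ext_atom_eq0 N L (x : Ext n (submod L) N) :
  colim_in (ext_restr n N) x = 0 -> exists K (h : sup_nzsub L K), ext_restr n N h x = 0.
Proof.
exact: (colim_in_eq0 sup_nzsub_trans nzsub_directed (@ext_restr_comp N)).
Qed.

Lemma ext_atom_pushE N N' (v : {linear N -> N'}) L (x : Ext n (submod L) N) :
  ext_atom_push n H v (colim_in (ext_restr n N) x) =
  colim_in (ext_restr n N') (ext_push n (submod L) v x).
Proof. exact: colim_descE. Qed.

Lemma ext_atom_push_comp N N' N'' (u : {linear N -> N'}) (v : {linear N' -> N''})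
    (w : {linear N -> N''}) (e : ExtAtomMod n H N) :
  nzsub H -> (forall x, w x = v (u x)) ->
  ext_atom_push n H v (ext_atom_push n H u e) = ext_atom_push n H w e.
Proof.
move=> L0 wE; have [L [x [_ _ ->]]] := ext_atom_surj L0 e.
by rewrite !ext_atom_pushE (ext_push_comp _ wE).
Qed.

(** [L'] is sL, and [v] is division by s. *)
Lemma shrink (M : lmodType A) (L : nzsub M) (s : A) (sC : forall a, s * a = a * s) :
  (forall x : M, s *: x = 0 -> x = 0) ->
  exists (L' : nzsub M) (h : {subset L' <= L}) (v : {linear submod L' -> submod L}),
    forall y, s *: v y = incl h y.
Proof.
move=> s_inj; pose L1 := im_submod (smul sC M) L.
have nz : nonzero L1.
  have [x xL x0] := nzsP L; exists (s *: x); first by apply/asboolP; exists x.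
  by apply: contraNneq x0 => /s_inj ->.
have h : {subset L1 <= L} by move=> y /asboolP[x xL ->]; rewrite /= rpredZ.
exists (NzSub nz), h.
have [x y|y|v vP] := @factor_through _ _ _ _ (smul sC (submod L)) (incl h); last by exists v.
  move=> /(congr1 (fun z => smval z))/= /eqP; rewrite -subr_eq0 -scalerBr => /eqP/s_inj/eqP.
  by rewrite subr_eq0 => /eqP/val_inj.
have /asboolP[x xL yx] := smvalP y.
by exists (SubMod xL); apply: val_inj; rewrite /= yx.
Qed.

(** The inclusion of sL is s times division by s, and s may act on the coefficients instead. Hence
    restriction to sL kills classes killed by s and undoes a multiplication by s. *)
Lemma ext_restr_shrink N L (s : A) (sC : forall a, s * a = a * s) :
  (forall x : H, s *: x = 0 -> x = 0) ->
  exists L' (h : sup_nzsub L L') (v : {linear submod L' -> submod L}),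
    forall N (c : Ext n (submod L) N),
      ext_pull n N v (ext_push n (submod L) (smul sC N) c) = ext_restr n N h c.
Proof.
move=> /(shrink L sC)[L' [h [v vP]]]; exists L', h, v => N' c.
by rewrite -ext_pull_smul; apply: ext_pull_comp => y; rewrite /= vP.
Qed.

Section Denominators.
Variable D : A -> Prop.
Hypothesis D1 : D 1.
Hypothesis DM : forall s t, D s -> D t -> D (s * t).
Hypothesis DC : forall s, D s -> forall a, s * a = a * s.
Hypothesis D_inj : forall s, D s -> forall x : H, s *: x = 0 -> x = 0.

(** A common denominator for the values on finitely many generators works on all of M. *)
Lemma common_lift (M N N' : lmodType A) (v : {linear N -> N'}) (f : {linear M -> N'}) :
  fgmod M -> injective v -> (forall y, exists2 s, D s & exists x, v x = s *: y) ->
  exists s, D s /\ exists f' : {linear M -> N}, forall z, v (f' z) = s *: f z.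
Proof.
move=> [r rP] vi vtors.
have [z s t Ds [x xz]|s Ds sP] :=
    @common_den A D D1 DM DC M r (fun z s => exists x, v x = s *: f z) _ (fun z =>
      vtors (f z)).
  by exists (s *: x); rewrite linearZ_LR /= xz scalerA.
exists s; split=> //.
have [z|f' f'P] := @factor_through _ _ _ _ v (smul (DC Ds) _ \o f) vi; last by exists f'.
move: z (rP z); apply: span_min => [|a z z' [x xz] [x' x'z']|//].
  by exists 0; rewrite /= !linear0 scaler0.
by exists (a *: x + x'); rewrite /= !linearP /= xz x'z' !scalerA scalerDr !scalerA (DC Ds).
Qed.

Hypothesis noethA : forall (M : lmodType A) (L : submodule M), fgmod M -> fgmod (submod L).

Lemma extendable_den (X : fgModule A) m N N' (v : {linear N -> N'})
    (g : hom (rsyz (fgres noethA X) m) N) :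
  injective v -> (forall y, exists2 s, D s & exists x, v x = s *: y) ->
  extendable (postcomp v g) ->
  exists s, exists Ds : D s, extendable (postcomp (smul (DC Ds) N) g).
Proof.
move=> vi vtors; case: m g => [|m] g /= => [vg|[k kP]].
  by exists 1, D1 => z; apply: vi; rewrite linearZ_LR /= vg scaler0 linear0.
have [s [Ds [f fP]]] := common_lift k (fgfree_fg (fgsyz noethA X m)) vi vtors.
by exists s, Ds, f => z; apply: vi; rewrite fP linearZ_LR /= -kP.
Qed.

(** Both halves compute with a finitely generated resolution, clear one denominator s, and undo s by
    restricting to a smaller submodule. *)
Lemma ext_atom_push_bij N N' (v : {linear N -> N'}) : nzsub H ->
  injective v -> (forall y, exists2 s, D s & exists x, v x = s *: y) ->
  bijective (ext_atom_push n H v).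
Proof.
move=> L0 vi vtors; apply: bijective_of => e.
  have [L [d [_ _ ->]]] := ext_atom_surj L0 e; rewrite ext_atom_pushE.
  move=> /ext_atom_eq0[L1 [h1]]; rewrite /ext_restr -ext_pull_push => d0.
  have [L2 [L21 L2fg]] := nzsub_fg L1; have h2 : sup_nzsub L1 L2 by [].
  have h := sup_nzsub_trans h1 h2.
  have {d0} : ext_push n (submod L2) v (ext_restr n N h d) = 0.
    by rewrite -(ext_restr_comp h1 h2) /ext_restr ext_pull_push d0 raddf0.
  rewrite -(colim_inP _ h); set d2 := ext_restr n N h d => d20.
  (* A class killed by s restricts to zero on a smaller submodule, so it vanishes in the direct
     limit. *)
  suff [s [Ds sd2]] : exists s, exists Ds : D s, ext_push n (submod L2) (smul (DC Ds) N) d2 = 0.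
    have [L3 [h3 [u uP]]] := ext_restr_shrink N L2 (DC Ds) (D_inj Ds).
    by rewrite -(colim_inP _ h3) -uP sd2 !raddf0.
  pose X := fgres noethA (FgModule L2fg).
  have [b bP] := ext_resolution X n.
  have [g d2g] := (bP N).1 d2; move: d20; rewrite d2g ext_push_class -precomp_postcomp.
  move=> /(bP N').2 vg.
  have [s [Ds sg]] := extendable_den vi vtors vg.
  by exists s, Ds; rewrite ext_push_class -precomp_postcomp; apply/(bP N).2.
have [L [x [_ Lfg ->]]] := ext_atom_surj L0 e.
pose X := fgres noethA (FgModule Lfg).
have [b bP] := ext_resolution X n.
have [f xf] := (bP N').1 x.
have [s [Ds [f' f'P]]] := common_lift f (fgP (fgsyz noethA (FgModule Lfg) n)) vi vtors.
have [L' [h [u uP]]] := ext_restr_shrink N' L (DC Ds) (D_inj Ds).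
(* [d] is represented by the lift of s f to N; pulling back along [u] divides by s again. *)
pose d : Ext n (submod L) N := ext_class (precomp b (to_hom f')).
exists (colim_in (ext_restr n N) (ext_pull n N u d)).
have vd : ext_push n (submod L) v d = ext_push n (submod L) (smul (DC Ds) N') x.
  rewrite xf !ext_push_class -!precomp_postcomp.
  by congr (ext_class (precomp b _)); apply: hom_ext => z /=; rewrite f'P.
by rewrite ext_atom_pushE ext_pull_push vd uP colim_inP.
Qed.

Hypothesis H_torsion : forall (L : nzsub H) (x : H), exists2 s, D s & s *: x \in L.

(** Some s in D maps the finitely generated [L0] into a given L1 inside it. As s is invertible on N,
    pulling back along this map and dividing by s inverts restriction from [L0] to L1. *)
Lemma colim_in_bij N (L0 : nzsub H) : fgmod (submod L0) ->
  (forall s, D s -> bijective (fun x : N => s *: x)) ->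
  bijective (@colim_in _ _ _ (ext_restr n N) L0).
Proof.
move=> L0fg Nbij.
have inv s (Ds : D s) : exists r : {linear N ->
  N}, (forall x, s *: r x = x) /\ (forall x, r (s *: x) = x).
  have [||r [rK Kr]] := @linear_inverse _ _ _ (smul (DC Ds) N); last by exists r.
    exact: bij_inj (Nbij s Ds).
  by move=> y; have [g _ gK] := Nbij s Ds; exists (g y); exact: gK.
have into (L1 : nzsub H) (h : sup_nzsub L0 L1) : exists s, exists Ds : D s,
    exists m : {linear submod L0 -> submod L1}, forall x, smval (m x) = s *: smval x.
  have [|s [Ds [m mP]]] := common_lift (v := smval (L := L1)) (smval (L := L0)) L0fg val_inj.
    by move=> y; have [s Ds sy] := H_torsion L1 y; exists s => //; exists (SubMod sy).
  by exists s, Ds, m.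
apply: bijective_of => [x|e].
  move=> /ext_atom_eq0[L1 [h x0]]; have [s [Ds [m mP]]] := into L1 h.
  have [r [_ rK]] := inv s Ds.
  have : ext_pull n N (smul (DC Ds) (submod L0)) x = 0.
    rewrite -[RHS](raddf0 (ext_pull n N m)) -x0; apply/esym/ext_pull_comp => y.
    by apply: val_inj; rewrite /= mP.
  rewrite ext_pull_smul => /(congr1 (ext_push n (submod L0) r)); rewrite raddf0.
  by rewrite (ext_push_comp (w := idfun)) ?ext_push_id // => y; rewrite /= rK.
have [L [y [LL0 _ ->]]] := ext_atom_surj L0 e.
have [s [Ds [m mP]]] := into L LL0; have [r [rK _]] := inv s Ds.
have rK' x : ext_push n (submod L) r (ext_push n (submod L) (smul (DC Ds) N) x) = x.
  by rewrite (ext_push_comp (w := idfun)) ?ext_push_id // => z;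
    apply: (bij_inj (Nbij s Ds)); rewrite /= rK.
exists (ext_push n (submod L0) r (ext_pull n N m y)).
have h : sup_nzsub L0 L := LL0.
apply: etrans (esym (colim_inP _ h _)) _; rewrite /ext_restr -ext_pull_push.
have -> : ext_pull n N (incl h) (ext_pull n N m y) = ext_push n (submod L) (smul (DC Ds) N) y.
  by rewrite -ext_pull_smul; apply: ext_pull_comp => z; apply: val_inj; rewrite /= mP.
by rewrite rK'.
Qed.
End Denominators.
End ExtOfAtom.

(** * Vanishing when an element separates the two atoms *)

Section Vanishing.
Variables (A : nzRingType) (n : nat).
Implicit Types M N : lmodType A.

Lemma ext_push_eq0 M N N' (v : {linear N -> N'}) (c : Ext n M N) :
  (forall y, v y = 0) -> ext_push n M v c = 0.
Proof.
move=> v0; have [f ->] := ext_class_surj c; rewrite ext_push_class.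
by rewrite -[RHS](raddf0 (@ext_class A n M N')); congr ext_class; apply: hom_ext => x;
  rewrite /= v0.
Qed.

Lemma ext_pull_eq0 M M' N (u : {linear M -> M'}) (c : Ext n M' N) :
  (forall x, u x = 0) -> ext_pull n N u c = 0.
Proof.
move=> u0; have zC (a : A) : 0 * a = a * 0 by rewrite mul0r mulr0.
(* A zero map absorbs multiplication by the central element 0, which then moves to the
   coefficients. *)
rewrite -(@ext_pull_comp A n _ _ _ _ (smul zC M) u u); last by move=> x; rewrite !u0.
by rewrite ext_pull_smul ext_push_eq0 // => x; rewrite /= scale0r.
Qed.

Variables (S T : lmodType A) (s : A) (sC : forall a, s * a = a * s).
Hypotheses (Suni : uniform S) (S0 : nzsub S).

Lemma ext_atom_eq0_target : (forall x : S, s *: x = 0 -> x = 0) ->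
  (forall y : T, s *: y = 0) -> forall e : ExtAtom n S T, e = 0.
Proof.
move=> s_inj sT e; apply: val_inj; apply/functional_extensionality_dep => K /=.
have [L [x [_ _ ->]]] := ext_atom_surj Suni S0 (limf e K).
have [L' [h [v vP]]] := ext_restr_shrink n (submod K) L sC s_inj.
(* Restriction to [L'] passes through multiplication by s on K, which is zero. *)
rewrite -(colim_inP _ h) -vP ext_push_eq0 ?raddf0 // => y.
by apply: val_inj; rewrite /= sT.
Qed.

Lemma ext_atom_eq0_source : (forall x : S, s *: x = 0) ->
  (forall y : T, s *: y = 0 -> y = 0) -> forall e : ExtAtom n S T, e = 0.
Proof.
move=> sS s_inj e; apply: val_inj; apply/functional_extensionality_dep => K /=.
have [K' [h [v vP]]] := shrink K sC s_inj.
have /asboolP/(_ K' K h) <- := limP e.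
(* The transition map is division by s followed by multiplication by s on K; the latter moves to the
   source, where s acts as zero. *)
rewrite /ext_atom_incl -(ext_atom_push_comp (u := v) (v := smul sC (submod K)) Suni) //;
  last first.
  by move=> x; rewrite /= vP.
have [L [x [_ _ ->]]] := ext_atom_surj Suni S0 (ext_atom_push n S v (limf e K')).
rewrite ext_atom_pushE -ext_pull_smul.
rewrite ext_pull_eq0 ?raddf0 // => y.
by apply: val_inj; rewrite /= sS.
Qed.
End Vanishing.

(** * Ext between the atoms of two prime ideals *)

Section Main.
Variables (R : comPzRingType) (Lam : algType R).
Hypotheses (noethR : noetherian_ring R) (noethLam : noetherian_algebra Lam).
Variables (n : nat) (P Q : primeSpec Lam) (IP IQ : lmodType Lam^c).
Hypotheses (hIP : is_I_of_prime P IP) (hIQ : is_I_of_prime Q IQ).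
Local Notation S := (S_mod P IP).
Local Notation T := (S_mod Q IQ).

Let S_top : nzsub S.
Proof. by apply: (@NzSub _ _ (full_submod S)); have [x x0] := S_nonzero hIP; exists x. Qed.

Lemma ext_atom_distinct : ~ contraction P =i contraction Q -> forall e : ExtAtom n S T, e = 0.
Proof.
move=> /existsNP[s sPQ].
have [sP|sP] := boolP (s \in contraction P); have [sQ|sQ] := boolP (s \in contraction Q).
- by case: sPQ; rewrite sP sQ.
- apply: (ext_atom_eq0_source (scal_central s) (S_uniform hIP) S_top) => [x|y].
    exact: S_killed.
  exact: (S_torsion_free hIQ sQ).
- apply: (ext_atom_eq0_target (scal_central s) (S_uniform hIP) S_top) => [x|y].
    exact: (S_torsion_free hIP sP).
  exact: S_killed.
- by case: sPQ; rewrite (negbTE sP) (negbTE sQ).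
Qed.

Hypothesis PQ : contraction P =i contraction Q.
Variables (Lamp : nzRingType) (phi : {rmorphism Lam -> Lamp}).
Hypothesis phi_loc : is_localization (contraction P) phi.

(** [phi] between the converse rings, over which right modules live. *)
Definition cophi : Lam^c -> Lamp^c := phi.
Fact cophi_zmod : zmod_morphism cophi.
Proof. exact: (raddfB phi). Qed.
Fact cophi_monoid : monoid_morphism cophi.
Proof. by split=> [|a b]; [exact: (rmorph1 phi) | exact: (rmorphM phi)]. Qed.
HB.instance Definition _ := GRing.isZmodMorphism.Build Lam^c Lamp^c cophi cophi_zmod.
HB.instance Definition _ := GRing.isMonoidMorphism.Build Lam^c Lamp^c cophi cophi_monoid.

Definition denominator (a : Lam^c) : Prop :=
  exists2 s, s \notin contraction P & a = scal Lam s.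

Lemma denominator1 : denominator 1.
Proof. by exists 1; [exact: contraction1 | rewrite rmorph1]. Qed.

Lemma denominatorM a b : denominator a -> denominator b -> denominator (a * b).
Proof.
move=> [s sP ->] [t tP ->]; exists (s * t); first exact: contractionM.
by rewrite rmorphM.
Qed.

Lemma denominator_central a : denominator a -> forall b, a * b = b * a.
Proof. by move=> [s _ ->]; exact: scal_central. Qed.

Lemma denominator_inv a : denominator a ->
  exists u : Lamp^c, u * cophi a = 1 /\ cophi a * u = 1.
Proof. by move=> [s sP ->]; have [inv _ _] := phi_loc; have [u [us su]] := inv s sP;
  exists u. Qed.

Lemma denominator_frac (c : Lamp^c) : exists a b, denominator a /\ cophi a * c = cophi b.
Proof.
have [_ frac _] := phi_loc; have [b [s [sP cs]]] := frac c.
by exists (scal Lam s), b; split=> //; exists s.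
Qed.

Lemma denominator_ker (b : Lam^c) : cophi b = 0 -> exists2 a, denominator a & a * b = 0.
Proof.
have [_ _ ker] := phi_loc; move=> /ker[s [sP sb]].
exists (scal Lam s); first by exists s.
by rewrite scal_central -[LHS]/((s%:A : Lam) * b) -scalerAl mul1r.
Qed.

Lemma extends_action_linear (M : lmodType Lam^c) (N : lmodType Lamp^c) :
  extends_action phi M N -> exists w : {linear M -> resc cophi N}, bijective w.
Proof.
move=> [f [fb fZ]].
have fl : linear (f : M -> resc cophi N).
  by move=> a x y; rewrite raddfD fZ.
have [w wE] := linear_mk fl; exists w.
by have [g fK gK] := fb; exists g => x; rewrite wE.
Qed.

(** First the inverse limit is constant, giving Ext(alpha, T); then the direct limit is its term at
    a finitely generated L0; finally the ring is changed along L0 -> SP. *)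
Lemma ext_atom_localized (SP SQ : lmodType Lamp^c) :
  extends_action phi S SP -> extends_action phi T SQ ->
  group_isomorphic (ExtAtom n S T) (Ext n SP SQ).
Proof.
move=> /extends_action_linear[u u_bij] /extends_action_linear[w w_bij].
have D_inj a : denominator a -> forall x : S, a *: x = 0 -> x = 0.
  by move=> [s sP ->] x; apply: (S_torsion_free hIP).
have S_tors (L : nzsub S) (x : S) : exists2 a, denominator a & a *: x \in L.
  have [s sP sx] := S_torsion_quotient hIP noethR noethLam (nzsP L) x.
  by exists (scal Lam s) => //; exists s.
(* Equality of the contractions enters here: torsion with respect to Q is torsion with respect to
   P. *)
have T_tors (L : nzsub T) (y : T) : exists2 a, denominator a & a *: y \in L.
  have [s sQ sy] := S_torsion_quotient hIQ noethR noethLam (nzsP L) y.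
  by exists (scal Lam s) => //; exists s => //; rewrite PQ.
have Suni := S_uniform hIP.
have T_nz : nonzero (full_submod T) by have [y y0] := S_nonzero hIQ; exists y.
pose T_top := NzSub T_nz.
have le_top (K : nzsub T) : sub_nzsub K T_top by [].
have step1 : group_isomorphic (ExtAtom n S T) (ExtAtomMod n S (submod T_top)).
  apply: (lim_top (le_top := le_top)) => [i j k h h' h'' x|K].
    by apply: (ext_atom_push_comp Suni _ S_top) => y; apply: val_inj.
  have incl_inj : injective (incl (le_top K)).
    by move=> x y /(congr1 (fun z => smval z))/= /val_inj.
  have incl_tors (y : submod T_top) :
      exists2 a, denominator a & exists x, incl (le_top K) x = a *: y.
    have [a Da ay] := T_tors K (smval y).
    by exists a => //; exists (SubMod ay); apply: val_inj.
  have noeth := @algebra_noetherian _ _ noethR noethLam.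
  exact: (ext_atom_push_bij n Suni denominator1 denominatorM denominator_central D_inj noeth
    S_top incl_inj incl_tors).
have [L0 [_ L0fg]] := nzsub_fg S_top.
pose w' : {linear submod T_top -> resc cophi SQ} := w \o smval (L := T_top).
have w'_bij : bijective w'.
  have [v wK vK] := w_bij.
  by exists (fun z => SubMod (isT : v z \in T_top)) => z; [apply: val_inj; rewrite /= wK |
    rewrite /= vK].
have top_bij a : denominator a -> bijective (fun x : submod T_top => a *: x).
  move=> Da; have [w'' w'K w''K] := w'_bij.
  have [i [ia ai]] := denominator_inv Da.
  exists (fun x => w'' (i *: (w' x : SQ))) => x.
    by rewrite linearZ_LR /= rescE scalerA ia scale1r w'K.
  by apply: (can_inj w'K); rewrite linearZ_LR w''K [LHS]rescE scalerA ai scale1r.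
have step2 : group_isomorphic (Ext n (submod L0) (submod T_top)) (ExtAtomMod n S (submod T_top)).
  exists (@colim_in _ _ _ (ext_restr n (submod T_top)) L0).
  exact: (colim_in_bij n Suni denominator1 denominatorM denominator_central S_tors L0fg
    top_bij).
apply: group_isomorphic_trans step1 _.
apply: group_isomorphic_trans (group_isomorphic_sym step2) _.
(* L0 has torsion quotient in S, so its embedding into SP is again a localization map. *)
pose u' : {linear submod L0 -> resc cophi SP} := u \o smval (L := L0).
have u'P : localization_map denominator u'.
  split=> [x ux0|y].
    exists 1; first exact: denominator1.
    by rewrite scale1r; apply: val_inj; apply: (bij_inj u_bij); rewrite [LHS]ux0 raddf0.
  have [v uK vK] := u_bij; have [a Da av] := S_tors L0 (v y).
  by exists a, (SubMod av); split=> //; rewrite /= linearZ_LR /= vK.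
exact: (ext_localization denominator1 denominatorM denominator_central denominator_inv
  denominator_frac denominator_ker u'P w'_bij).
Qed.
End Main.

Theorem theorem1p5 (R : comPzRingType) (Lam : algType R)
    (noethR : noetherian_ring R) (noethLam : noetherian_algebra Lam)
    (i : nat) (P Q : primeSpec Lam)
    (IP IQ : lmodType Lam^c) (hIP : is_I_of_prime P IP) (hIQ : is_I_of_prime Q IQ) :
  (contraction P =i contraction Q ->
    forall (Lamp : nzRingType) (phi : {rmorphism Lam -> Lamp}),
      is_localization (contraction P) phi ->
    forall SP SQ : lmodType Lamp^c,
      extends_action phi (S_mod P IP) SP ->
      extends_action phi (S_mod Q IQ) SQ ->
    group_isomorphic (ExtAtom i (S_mod P IP) (S_mod Q IQ)) (Ext i SP SQ)) /\
  (~ contraction P =i contraction Q ->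
    forall x : ExtAtom i (S_mod P IP) (S_mod Q IQ), x = 0).
Proof.
split=> [PQ Lamp phi phi_loc SP SQ|PQ].
  exact: ext_atom_localized.
exact: ext_atom_distinct.
Qed.
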